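(* Let $X$ be a finite alphabet with at least two letters and let $k\ge 2$. The quotient-posets of $(\mathcal{R}_k;\leq_{CA})$, of $(\mathcal{A}_k;\leq_{CA})$, and of $(\mathcal{F}_{\mathcal{T}_k};\leq_h)$ are pairwise isomorphic.
   Context: $X^\omega$ is the set of infinite words over $X$ with the Cantor (product) topology; $\bar k=\{0,\dots,k-1\}$. A $k$-partition of $X^\omega$ is a function $L:X^\omega\to\bar k$; its components are $L^{-1}(i)$, $i<k$. An automaton is $\mathcal{M}=(Q,f,in)$ with finite state set $Q$, transition function $f:Q\times X\to Q$ (extended to words as usual) and initial state $in$. For $\xi\in X^\omega$, $f_{\mathcal M}(\xi)$ is the set of states occurring infinitely often in the run $f(in,\xi\upharpoonright_n)$, $n<\omega$. A Muller acceptor $(\mathcal M,\mathcal F)$ recognises $\{\xi: f_{\mathcal M}(\xi)\in\mathcal F\}$; such sets are the regular $\omega$-languages. $\mathcal M$ is aperiodic if for all states $q$, nonempty words $u$ and $n>0$, $f(q,u^n)=q$ implies $f(q,u)=q$; an $\omega$-language is aperiodic if recognised by a Muller acceptor with aperiodic automaton. $\mathcal{R}_k$ (resp. $\mathcal{A}_k$) is the set of $k$-partitions of $X^\omega$ all of whose components are regular (resp. aperiodic). For $k$-partitions $A,B$, $A\leq_{CA}B$ iff $A=B\circ g$ for some continuous $g:X^\omega\to X^\omega$. For a preorder $Q$, a $Q$-forest is a finite nonempty poset in which every lower cone $\{y:y\le x\}$ is a chain, equipped with a labeling $c$ into $Q$; a $Q$-tree is a $Q$-forest with a least element. For $Q$-forests,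 $(P,c)\leq_h(P',c')$ iff there is a monotone map $\varphi:P\to P'$ with $c(x)\le c'(\varphi(x))$ for all $x\in P$. $\mathcal{T}_k$ is the set of $\bar k$-trees ($\bar k$ ordered as an antichain, i.e. labels must be equal) with $\le_h$; $\mathcal{F}_{\mathcal{T}_k}$ is the set of $\mathcal{T}_k$-forests (forests whose nodes are labeled by elements of $\mathcal{T}_k$, labels compared by $\le_h$), preordered by $\le_h$. *)

(* Defs.v *)
From mathcomp Require Import all_boot.
Set Implicit Arguments. Unset Strict Implicit. Unset Printing Implicit Defensive.

Definition word (X : Type) := nat -> X.

Definition agree (X : Type) (m : nat) (xi eta : word X) : Prop :=
  forall i, i < m -> xi i = eta i.

(* continuity of g : X^omega -> X^omega for the Cantor (product of discrete)
   topology, unfolded: every finite output prefix depends on a finite input prefix *)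
Definition cantor_continuous (X : Type) (g : word X -> word X) : Prop :=
  forall (xi : word X) (n : nat), exists m : nat,
    forall eta : word X, agree m xi eta -> agree n (g xi) (g eta).

Definition kpartition (X : Type) (k : nat) := word X -> 'I_k.

Definition leCA (X : Type) (k : nat) (A B : kpartition X k) : Prop :=
  exists g : word X -> word X, cantor_continuous g /\ forall xi, A xi = B (g xi).

Record automaton (X : Type) := Automaton {
  state : finType;
  trans : state -> X -> state;
  init : state }.

Definition ftrans (X : Type) (M : automaton X) (q : state M) (u : seq X) : state M :=
  foldl (@trans X M) q u.

Definition run (X : Type) (M : automaton X) (xi : word X) (n : nat) : state M :=
  ftrans (init M) (mkseq xi n).

Definition inf_states (X : Type) (M : automaton X) (xi : word X) (S : {set state M}) : Prop :=
  forall q : state M, q \in S <-> (forall n, exists m, n <= m /\ @run X M xi m = q).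

Definition muller_recognises (X : Type) (M : automaton X) (F : {set {set state M}})
  (L : word X -> Prop) : Prop :=
  forall xi, L xi <-> exists2 S, S \in F & @inf_states X M xi S.

Definition aperiodic_automaton (X : Type) (M : automaton X) : Prop :=
  forall (q : state M) (u : seq X) (n : nat), u <> [::] -> 0 < n ->
    ftrans q (flatten (nseq n u)) = q -> ftrans q u = q.

Definition regular (X : finType) (L : word X -> Prop) : Prop :=
  exists (M : automaton X) (F : {set {set state M}}), muller_recognises F L.

Definition aperiodic (X : finType) (L : word X -> Prop) : Prop :=
  exists (M : automaton X) (F : {set {set state M}}),
    aperiodic_automaton M /\ muller_recognises F L.

Definition Rk (X : finType) (k : nat) :=
  { L : kpartition X k | forall i : 'I_k, regular (fun xi => L xi = i) }.
Definition Ak (X : finType) (k : nat) :=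
  { L : kpartition X k | forall i : 'I_k, aperiodic (fun xi => L xi = i) }.

Definition leR (X : finType) (k : nat) (A B : Rk X k) : Prop := leCA (proj1_sig A) (proj1_sig B).
Definition leA (X : finType) (k : nat) (A B : Ak X k) : Prop := leCA (proj1_sig A) (proj1_sig B).

Record forest (Q : Type) := Forest {
  fsize : nat;
  fle : rel 'I_fsize;
  flab : 'I_fsize -> Q;
  fsize_gt0 : 0 < fsize;
  fle_refl : reflexive fle;
  fle_anti : forall x y, fle x y -> fle y x -> x = y;
  fle_trans : transitive fle;
  fle_cone_chain : forall x y z, fle y x -> fle z x -> fle y z || fle z y }.

Definition is_tree (Q : Type) (P : forest Q) : Prop :=
  exists r : 'I_(fsize P), forall x, @fle Q P r x.

Definition leh (Q : Type) (leQ : Q -> Q -> Prop) (P P' : forest Q) : Prop :=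
  exists phi : 'I_(fsize P) -> 'I_(fsize P'),
    (forall x y, @fle Q P x y -> @fle Q P' (phi x) (phi y)) /\
    (forall x, leQ (@flab Q P x) (@flab Q P' (phi x))).

Definition Tk (k : nat) := { T : forest 'I_k | is_tree T }.
Definition leT (k : nat) (T T' : Tk k) : Prop := leh (@eq 'I_k) (proj1_sig T) (proj1_sig T').

Definition FTk (k : nat) := forest (Tk k).
Definition leF (k : nat) (F F' : FTk k) : Prop := leh (@leT k) F F'.

(* The quotient posets of preorders (A,leA) and (B,leB) are isomorphic iff there is
   a map phi : A -> B reflecting and preserving the preorder and surjective up to
   the equivalence of B (it then induces an order isomorphism of the quotients). *)
Definition quotient_iso (A B : Type) (leA : A -> A -> Prop) (leB : B -> B -> Prop) : Prop :=
  exists phi : A -> B,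
    (forall x y, leA x y <-> leB (phi x) (phi y)) /\
    (forall b, exists a, leB (phi a) b /\ leB b (phi a)).

(* Main.v *)
From mathcomp Require Import all_boot.
From mathcomp Require Import boolp.
Require Import Defs.
Set Implicit Arguments. Unset Strict Implicit. Unset Printing Implicit Defensive.

(** Present a regular k-partition by one automaton together with a colouring of its cycles
    (the sets of states that runs can visit infinitely often).  Its forest is obtained by
    unfolding the strongly connected components ordered by reachability, and by labelling a
    component with the unfolding of its subcycles ordered by reverse inclusion.  It is the
    [leF]-greatest forest [F] that embeds in the automaton: inner nodes are mapped to cycles
    of the right colour, decreasing along inner trees, and outer nodes to cycles, reachable one
    from the other along the outer forest.

    - A continuous reduction transports embeddings.  Call a pair [(w, v)] admissible when [g]
      maps the cylinder of [w] into that of [v]; among the admissible extensions of [(w, v)]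
      whose input stays in a cycle [S], choose one whose set of still attainable target states
      is minimal.  That set is then a cycle with the colour of [S], and it shrinks when [S]
      does.
    - If the forest of [A] embeds in [B] then [A] reduces to [B].  While reading the input,
      follow the set of states met since the previous visit to the current state: this set is
      eventually included in, and infinitely often equal to, the limit set.  Moving to an
      extension of the deepest ancestor whose cycle contains it gives a sequence of nodes that
      stays above a single node and returns to it infinitely often; let the output tour the
      corresponding cycles of [B].
    - Every forest is realized by an aperiodic automaton that reads unary codes of nodes,
      obeys those that do not go backwards in the outer forest, and colours a set of nodes by
      the label of its greatest lower bound in the inner tree. *)

(** * Words and runs *)

Section Prefix.
Variable X : Type.
Implicit Types (u v w : seq X) (xi eta : word X).

Definition pre w xi := mkseq xi (size w) = w.
Definition shift n xi : word X := fun i => xi (n + i).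

Lemma mkseqD xi n d : mkseq xi (n + d) = mkseq xi n ++ mkseq (shift n xi) d.
Proof.
rewrite /mkseq iotaD map_cat add0n; congr (_ ++ _).
by rewrite -[n in iota n]addn0 iotaDl -map_comp.
Qed.

Lemma pre_catl u v xi : pre (u ++ v) xi -> pre u xi.
Proof.
rewrite /pre size_cat mkseqD => /(congr1 (take (size u))).
by rewrite !take_size_cat ?size_mkseq.
Qed.

Lemma pre_catr u v xi : pre (u ++ v) xi -> pre v (shift (size u) xi).
Proof.
rewrite /pre size_cat mkseqD => /(congr1 (drop (size u))).
by rewrite !drop_size_cat ?size_mkseq.
Qed.

Lemma pre0 xi : pre [::] xi.
Proof. by []. Qed.

Lemma mkseq_take xi n m : n <= m -> take n (mkseq xi m) = mkseq xi n.
Proof. by move=> le_nm; rewrite -(subnKC le_nm) mkseqD take_size_cat ?size_mkseq. Qed.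

Lemma agreeP m xi eta : agree m xi eta <-> mkseq xi m = mkseq eta m.
Proof.
split=> [ag|e i lt_im].
  by apply/eq_in_map => i; rewrite mem_iota add0n => /andP[_]; apply: ag.
have /(congr1 (fun s => nth (xi i) s i)) := e.
by rewrite !nth_mkseq.
Qed.

(** * Growing chains of finite words and their limits *)

Section Chain.
Variables (W v : nat -> seq X).
Hypothesis Wcat : forall n, W n.+1 = W n ++ v n.
Hypothesis Wbig : forall n, exists m, n <= size (W m).

Lemma chain_cat n d : exists s, W (n + d) = W n ++ s.
Proof.
elim: d => [|d [s es]]; first by exists [::]; rewrite addn0 cats0.
by exists (s ++ v (n + d)); rewrite addnS Wcat es catA.
Qed.

Lemma chain_size n m : n <= m -> size (W n) <= size (W m).
Proof.
by move=> /subnKC<-; have [s ->] := chain_cat n (m - n); rewrite size_cat leq_addr.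
Qed.

Lemma chain_nth x0 n m i : i < size (W n) -> i < size (W m) ->
  nth x0 (W n) i = nth x0 (W m) i.
Proof.
wlog le_nm : n m / n <= m.
  by move=> H; case/orP: (leq_total n m) => [/H//|/H h ? ?]; rewrite h.
move=> lt_i _; have [s] := chain_cat n (m - n).
by rewrite subnKC // => ->; rewrite nth_cat lt_i.
Qed.

(** Letter [i] of the limit is read off any [W m] longer than [i]; by [chain_nth] the choice is
    immaterial. A nonempty [W m0] supplies the default letter for [nth]. *)
Lemma chain_limit : exists xi, forall n, pre (W n) xi.
Proof.
have [m0] := Wbig 1; case def_w: (W m0) => [//|x0 w] _.
have /choice[N HN] : forall i, exists m, i < size (W m) by move=> i; apply: Wbig.
exists (fun i => nth x0 (W (N i)) i) => n; apply: (@eq_from_nth _ x0).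
  by rewrite size_mkseq.
by move=> i; rewrite size_mkseq => lt_i; rewrite nth_mkseq //; apply: chain_nth.
Qed.

End Chain.
End Prefix.

(** * Runs, cycles and limit sets *)

Section Automata.
Variables (X : Type) (M : automaton X).
Implicit Types (p q : state M) (u v w : seq X) (S : {set state M}) (xi : word X).

(** Both end states are included, so the visits along [u] and along [v] share the state where
    [u ++ v] is cut. *)
Definition vis q u := q :: scanl (@trans X M) q u.
Definition within S q u := all (fun p => p \in S) (vis q u).
Definition reach p q := exists u, ftrans p u = q.
Definition at_ w := ftrans (init M) w.

Lemma ftrans_cat q u v : ftrans q (u ++ v) = ftrans (ftrans q u) v.
Proof. exact: foldl_cat. Qed.

Lemma at_cat u v : at_ (u ++ v) = ftrans (at_ u) v.
Proof. exact: ftrans_cat. Qed.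

Lemma visP p q u :
  reflect (exists2 i, i <= size u & p = ftrans q (take i u)) (p \in vis q u).
Proof.
apply: (iffP (nthP q)) => [[i lt_i <-]|[i le_i ->]]; exists i.
- by move: lt_i; rewrite /= size_scanl.
- by rewrite nth_cons_scanl //; move: lt_i; rewrite /= size_scanl.
- by rewrite /= size_scanl.
- by rewrite nth_cons_scanl.
Qed.

Lemma vis_last q u : ftrans q u \in vis q u.
Proof. by apply/visP; exists (size u) => //; rewrite take_size. Qed.

Lemma vis_cat p q u v :
  (p \in vis q (u ++ v)) = (p \in vis q u) || (p \in vis (ftrans q u) v).
Proof.
rewrite /vis scanl_cat -cat_cons mem_cat [in X in _ = _ || X]in_cons.
by case: eqP => [->|//]; rewrite -/(ftrans q u) vis_last.
Qed.

Lemma withinP S q u : reflect {subset vis q u <= S} (within S q u).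
Proof. exact: allP. Qed.

Lemma within_cat S q u v :
  within S q (u ++ v) = within S q u && within S (ftrans q u) v.
Proof.
apply/withinP/andP => [H|[/withinP Hu /withinP Hv] p].
  by split; apply/withinP => p Hp; apply: H; rewrite vis_cat Hp ?orbT.
by rewrite vis_cat => /orP[/Hu|/Hv].
Qed.

Lemma within_sub S S' q u : S \subset S' -> within S q u -> within S' q u.
Proof. by move=> /subsetP sub /withinP H; apply/withinP => p /H/sub. Qed.

Lemma within_last S q u : within S q u -> ftrans q u \in S.
Proof. by move/withinP; apply; apply: vis_last. Qed.

Lemma within_nil S q : within S q [::] = (q \in S).
Proof. by rewrite /within /= andbT. Qed.

Lemma reach_refl p : reach p p.
Proof. by exists [::]. Qed.

Lemma reach_trans q p r : reach p q -> reach q r -> reach p r.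
Proof. by case=> u <- [v <-]; exists (u ++ v); rewrite ftrans_cat. Qed.

Lemma reach_vis p q u : p \in vis q u -> reach q p.
Proof. by case/visP => i _ ->; exists (take i u). Qed.

Lemma vis_reach p q u : p \in vis q u -> reach p (ftrans q u).
Proof.
case/visP => i _ ->; exists (drop i u).
by rewrite -ftrans_cat cat_take_drop.
Qed.

Lemma runE xi n : run M xi n = at_ (mkseq xi n).
Proof. by []. Qed.

Lemma runD xi n d : run M xi (n + d) = ftrans (run M xi n) (mkseq (shift n xi) d).
Proof. by rewrite !runE mkseqD at_cat. Qed.

Lemma run_pre w xi : pre w xi -> run M xi (size w) = at_ w.
Proof. by rewrite runE => ->. Qed.

Lemma vis_run xi n d p :
  reflect (exists2 i, n <= i <= n + d & p = run M xi i)
          (p \in vis (run M xi n) (mkseq (shift n xi) d)).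
Proof.
apply: (iffP (visP _ _ _)) => [[i]|[i /andP[le_ni le_id]]] ; rewrite ?size_mkseq.
  move=> le_i ->; exists (n + i); first by rewrite leq_addr leq_add2l.
  by rewrite runD mkseq_take.
have le_ind : i - n <= d by rewrite leq_subLR.
by exists (i - n); rewrite ?size_mkseq // mkseq_take // -runD subnKC.
Qed.

Lemma reach_run xi n m : n <= m -> reach (run M xi n) (run M xi m).
Proof. by move=> /subnKC<-; rewrite runD; exists (mkseq (shift n xi) (m - n)). Qed.

(** Requiring [u <> [::]] rejects the singleton of a state without a self-loop, which is no limit
    set. *)
Definition cyc S := [/\ exists q, q \in S, forall q, q \in S -> reach (init M) q &
  forall p q, p \in S -> q \in S ->
    exists u, [/\ u <> [::], within S p u & ftrans p u = q]].

(** Connecting words are concatenated along an enumeration of [S]; a last one leads to [q] and makes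
    [u] nonempty. *)
Lemma tour S p q : cyc S -> p \in S -> q \in S ->
  exists u, [/\ u <> [::], within S p u, {subset S <= vis p u} & ftrans p u = q].
Proof.
move=> [_ _ conn] Sp Sq.
suff [u [wu su]] : exists u, within S p u /\ {subset S <= vis p u}.
  have [v [v0 wv ev]] := conn _ _ (within_last wu) Sq.
  exists (u ++ v); split; first by case: (u) v0.
  - by rewrite within_cat wu.
  - by move=> r /su; rewrite vis_cat => ->.
  - by rewrite ftrans_cat.
have H (s : seq (state M)) : {subset s <= S} ->
    exists u, within S p u /\ {subset s <= vis p u}.
  elim: s => [|r s IHs] sS; first by exists [::]; rewrite within_nil.
  have [u [wu su]] := IHs (fun x sx => sS x (mem_behead (s := r :: s) sx)).
  have [v [_ wv ev]] := conn _ _ (within_last wu) (sS r (mem_head r s)).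
  exists (u ++ v); rewrite within_cat wu; split=> // x; rewrite vis_cat inE.
  by case/predU1P => [->|/su->//]; rewrite -ev vis_last orbT.
have [|u [wu su]] := H (enum S); first by move=> x; rewrite mem_enum.
by exists u; split=> // x Sx; apply: su; rewrite mem_enum.
Qed.

Lemma inf_states_uniq xi S S' : inf_states xi S -> inf_states xi S' -> S = S'.
Proof. by move=> H H'; apply/setP => q; apply/idP/idP => [/H/H'|/H'/H]. Qed.

Definition infset xi : {set state M} :=
  [set q | `[<forall n, exists m, n <= m /\ run M xi m = q>]].

Lemma infsetP xi : inf_states xi (infset xi).
Proof. by move=> q; rewrite inE; split=> /asboolP. Qed.

Lemma inf_states_infset xi S : inf_states xi S -> S = infset xi.
Proof. by move/inf_states_uniq; apply; apply: infsetP. Qed.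

Lemma infset_eventually xi : exists n, forall m, n <= m -> run M xi m \in infset xi.
Proof.
have /choice[N HN] : forall q, exists n, forall m,
    q \notin infset xi -> n <= m -> run M xi m <> q.
  move=> q; have [//|nq] := boolP (q \in infset xi); first by exists 0.
  move: nq; rewrite inE => /asboolPn/existsNP[n] /forallNP H.
  by exists n => m _ le_nm e; apply: (H m).
exists (\max_q N q) => m le_m; apply/negPn/negP => nq.
by apply: (HN _ _ nq _ erefl); apply: leq_trans le_m; apply: leq_bigmax.
Qed.

Lemma cyc_infset xi : cyc (infset xi).
Proof.
have [n Hn] := infset_eventually xi.
split; first by exists (run M xi n); apply: Hn.
  by move=> q /(infsetP xi q)/(_ 0)[m [_ <-]]; exists (mkseq xi m).
move=> p q /(infsetP xi p)/(_ n)[i [le_ni <-]] /(infsetP xi q)/(_ i.+1)[j [lt_ij <-]].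
exists (mkseq (shift i xi) (j - i)); split.
- by move/(congr1 size)/eqP; rewrite size_mkseq /= subn_eq0 leqNgt lt_ij.
- apply/withinP => r /vis_run[l /andP[le_il _] ->]; apply: Hn; exact: leq_trans le_il.
- by rewrite -runD subnKC // ltnW.
Qed.

(** Computes a limit set from a factorization into blocks: beyond [W n0] every position falls into a
    block that stays in [S], and each state of [S] recurs in later and later blocks. Blocks may be
    empty as long as the total length is unbounded. *)
Lemma inf_blocks xi (W v : nat -> seq X) S n0 :
    (forall n, W n.+1 = W n ++ v n) -> (forall n, exists m, n <= size (W m)) ->
    (forall n, pre (W n) xi) ->
    (forall n, n0 <= n -> within S (at_ (W n)) (v n)) ->
    (forall q n, q \in S -> exists2 m, n <= m & q \in vis (at_ (W m)) (v m)) ->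
  inf_states xi S.
Proof.
move=> Wcat Wbig preW inS allS q; split=> [Sq n|infq].
  have [m0 le_n] := Wbig n; have [m le_m /visP[i le_i ->]] := allS q m0 Sq.
  exists (size (W m) + i); split.
    by apply: leq_trans le_n _; apply: leq_trans (leq_addr _ _); apply: (chain_size Wcat).
  rewrite runD run_pre //; congr (ftrans _ _).
  have := preW m.+1; rewrite Wcat => /pre_catr.
  by rewrite /pre => <-; rewrite mkseq_take.
have [i [le_i <-]] := infq (size (W n0)).
have [m le_im] := Wbig i.
(* The block of index at least [n0] that contains position [i]. *)
have: exists2 n, n0 <= n & size (W n) <= i <= size (W n.+1).
  have {le_im} : i <= size (W (n0 + m)).
    by apply: leq_trans le_im _; apply: (chain_size Wcat); rewrite leq_addl.
  elim: m => [|m IHm]; rewrite ?addn0 ?addnS => le_im.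
    by exists n0; rewrite ?le_i //= Wcat size_cat (leq_trans le_im) ?leq_addr.
  have [/IHm//|lt_i] := leqP i (size (W (n0 + m))).
  by exists (n0 + m); rewrite ?leq_addr // (ltnW lt_i).
case=> n le_n /andP[le_ni]; rewrite Wcat size_cat => le_in.
have /withinP := inS n le_n; apply; apply/visP; exists (i - size (W n)).
  by rewrite leq_subLR.
have := preW n.+1; rewrite Wcat => /pre_catr; rewrite /pre => <-.
by rewrite mkseq_take ?leq_subLR // -(run_pre (preW n)) -runD subnKC.
Qed.

(** Only limit sets constrain [col]; its values on other sets are arbitrary. *)
Definition colored k (L : kpartition X k) (col : {set state M} -> 'I_k) :=
  forall xi S, inf_states xi S -> L xi = col S.

End Automata.

(** * Forests *)

Lemma chain_max (V : finType) (le : rel V) (A : {set V}) :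
    transitive le -> reflexive le ->
    {in A &, forall x y, le x y || le y x} -> A != set0 ->
  exists2 m, m \in A & {in A, forall x, le x m}.
Proof.
move=> le_trans le_refl; move: {2}#|A| (leqnn #|A|) => n.
elim: n A => [|n IHn] A leA chA nA.
  by move: leA; rewrite leqn0 cards_eq0 (negPf nA).
case/set0Pn: (nA) => a Aa; have [A1|A1] := eqVneq (A :\ a) set0.
  exists a => // x Ax; have: x \notin A :\ a by rewrite A1 inE.
  by rewrite !inE Ax andbT negbK => /eqP->.
have [||m /setD1P[_ Am] max_m] := IHn (A :\ a) _ _ A1.
- by rewrite -ltnS; apply: leq_trans leA; rewrite [X in _ < X](cardsD1 a) Aa.
- by move=> x y /setD1P[_ Ax] /setD1P[_ Ay]; apply: chA.
case/orP: (chA _ _ Aa Am) => [am|ma]; [exists m|exists a] => // x Ax.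
  by have [->//|xa] := eqVneq x a; apply: max_m; rewrite !inE xa.
have [->//|xa] := eqVneq x a; apply: le_trans ma; apply: max_m; rewrite !inE xa //.
Qed.

Lemma forest_of_finType (V : finType) (le : rel V) (Q : Type) (lab : V -> Q) :
    (exists v : V, true) -> reflexive le ->
    (forall x y, le x y -> le y x -> x = y) -> transitive le ->
    (forall x y z, le y x -> le z x -> le y z || le z y) ->
  exists (F : forest Q) (f : 'I_(fsize F) -> V) (h : V -> 'I_(fsize F)),
    [/\ cancel f h, cancel h f, forall x y, fle x y = le (f x) (f y)
      & forall x, flab x = lab (f x)].
Proof.
case=> v _ le_refl le_anti le_trans le_chain.
have V0 : 0 < #|V| by apply/card_gt0P; exists v.
pose r : rel 'I_#|V| := fun x y => le (enum_val x) (enum_val y).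
have r_refl : reflexive r by move=> x; apply: le_refl.
have r_anti x y : r x y -> r y x -> x = y.
  by move=> xy yx; apply: enum_val_inj; apply: le_anti.
have r_trans : transitive r by move=> y x z; apply: le_trans.
have r_chain x y z : r y x -> r z x -> r y z || r z y by apply: le_chain.
exists (@Forest Q #|V| r (fun x => lab (enum_val x)) V0 r_refl r_anti r_trans r_chain).
exists enum_val, enum_rank; split=> //; [exact: enum_valK|exact: enum_rankK].
Qed.

(** * Unfolding a finite ordered set into a forest of chains *)

Section Unfold.
Variables (V : finType) (D B : {set V}) (le : rel V) (Q : Type) (lab : V -> Q).
Hypotheses (le_refl : reflexive le) (le_trans : transitive le).
Hypothesis le_anti : {in D &, forall x y, le x y -> le y x -> x = y}.
Hypotheses (BD : B \subset D) (Bmin : {in B & D, forall b x, le b x}).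
Hypothesis D0 : D != set0.

Let chain (c : {set V}) :=
  [&& B \subset c, c \subset D, c != set0 & [forall x in c, forall y in c, le x y || le y x]].

Let initial (c d : {set V}) :=
  (c \subset d) && [forall x in c, forall y in d, le y x ==> (y \in c)].

Let chainP c : chain c ->
  [/\ B \subset c, c \subset D, c != set0 & {in c &, forall x y, le x y || le y x}].
Proof.
case/and4P=> h1 h2 h3 /forall_inP h4; split=> // x y cx cy.
by apply: (forall_inP (h4 x cx)).
Qed.

Let initialP (c d : {set V}) : reflect (c \subset d /\ {in c & d, forall x y, le y x -> y \in c})
  (initial c d).
Proof.
apply: (iffP andP) => -[sub H]; split=> //.
  by move=> x y cx dy yx; have /forall_inP/(_ x cx)/forall_inP/(_ y dy)/implyP := H; apply.
by apply/forall_inP => x cx; apply/forall_inP => y dy; apply/implyP; apply: H.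
Qed.

(* The nodes are the nonempty chains of [D] containing [B], ordered by being an initial segment
   and labelled by their greatest elements.  [B] is either empty or consists of the least
   element of [D]; in the latter case the unfolding is a tree. *)
Lemma chain_unfolding :
  exists (F : forest Q) (m : 'I_(fsize F) -> V),
    [/\ forall x, m x \in D /\ flab x = lab (m x),
        forall x y, fle x y -> le (m x) (m y) /\ (m x = m y -> x = y),
        forall p, p \in D -> exists x, m x = p,
        forall x p, p \in D -> le (m x) p -> exists2 y, fle x y & m y = p
      & (B != set0 -> is_tree F) /\
        forall Q' (R : Q' -> Q -> Prop) (G : forest Q') (f : 'I_(fsize G) -> V),
          (forall x, f x \in D) -> (forall x y, fle x y -> le (f x) (f y)) ->
          (forall x, R (flab x) (lab (f x))) ->
        exists phi : 'I_(fsize G) -> 'I_(fsize F),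
          (forall x y, fle x y -> fle (phi x) (phi y)) /\
          (forall x, R (flab x) (flab (phi x)))].
Proof.
pose N := {c : {set V} | chain c}.
pose mkN c (ch : chain c) : N := exist (fun c => is_true (chain c)) c ch.
have Nch (c : N) : chain (val c) := valP c.
have top_ex (c : N) : exists t, t \in val c /\ {in val c, forall x, le x t}.
  have [_ _ c0 ch] := chainP (Nch c).
  by have [t ? ?] := chain_max le_trans le_refl ch c0; exists t.
have [top topP] := choice top_ex.
have top_in c : top c \in val c := proj1 (topP c).
have top_max (c : N) x : x \in val c -> le x (top c) := proj2 (topP c) x.
have sD (c : N) x : x \in val c -> x \in D.
  by have [_ /subsetP sub _ _] := chainP (Nch c); apply: sub.
have topE (c : N) t : t \in val c -> {in val c, forall x, le x t} -> top c = t.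
  move=> ct maxt; apply: le_anti; rewrite ?(sD c) //; first exact: maxt.
  exact: top_max.
(* Adjoins a greatest element [p] to a chain; the case [c = set0] starts a chain from [B] and [p]
   alone, since chains are nonempty by definition. *)
have chain1 p (c : {set V}) : (c = set0 \/ chain c) -> p \in D ->
    (forall x, x \in c -> le x p) -> chain (p |: (B :|: c)).
  move=> hc Dp le_p; apply/and4P; split.
  - by rewrite setUCA subsetUl.
  - rewrite !subUset BD sub1set Dp /=.
    by case: hc => [->|/chainP[]//]; rewrite sub0set.
  - by apply/set0Pn; exists p; rewrite setU11.
  have le_p' x : x \in B :|: c -> le x p by case/setUP => [Bx|/le_p//]; apply: Bmin.
  have cD x : x \in c -> x \in D.
    by case: hc => [->|/chainP[_ /subsetP sub _ _]]; [rewrite inE|apply: sub].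
  apply/forall_inP => x /setU1P[->|cx]; apply/forall_inP => y /setU1P[->|cy].
  - by rewrite le_refl.
  - by rewrite (le_p' y) ?orbT.
  - by rewrite (le_p' x).
  have uD z : z \in B :|: c -> z \in D by case/setUP => [/(subsetP BD)|/cD].
  have [Dx Dy] := (uD _ cx, uD _ cy).
  case/setUP: cx => [Bx|cx]; first by rewrite Bmin.
  case/setUP: cy => [By|cy]; first by rewrite (Bmin By Dx) orbT.
  by move: cx; case: hc => [->|/chainP[_ _ _ ch] cx]; [rewrite inE|apply: ch].
have [p0 Dp0] := set0Pn _ D0.
have ini_refl : reflexive (fun c d : N => initial (val c) (val d)).
  by move=> c; apply/initialP; split.
have [||||F [m [h [mK hK leF labF]]]] := @forest_of_finType N
    (fun c d => initial (val c) (val d)) Q (fun c => lab (top c)) _ ini_refl.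
- by have ch := chain1 p0 set0 (or_introl erefl) Dp0 ltac:(by move=> x; rewrite inE);
    exists (mkN _ ch).
- move=> c d /initialP[s1 _] /initialP[s2 _].
  by apply: val_inj; apply/eqP; rewrite eqEsubset s1.
- move=> d c e /initialP[s1 i1] /initialP[s2 i2]; apply/initialP; split.
    exact: subset_trans s2.
  move=> x y cx ey yx; apply: (i1 x) => //; apply: (i2 x) => //.
  exact: (subsetP s1).
- move=> e c d /initialP[s1 i1] /initialP[s2 i2].
  (* Two initial segments of the chain [e] are comparable: a point of [c] outside [d] lies above all
     of [d]. *)
  have [sub|/subsetPn[x cx ndx]] := boolP (val c \subset val d).
    apply/orP; left; apply/initialP; split=> // x y cx dy; apply: i1 => //.
    exact: (subsetP s2).
  apply/orP; right; apply/initialP; split.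
    apply/subsetP => y dy; have [_ _ _ ch] := chainP (Nch e).
    have [ex ey] := (subsetP s1 _ cx, subsetP s2 _ dy).
    case/orP: (ch _ _ ex ey) => [xy|]; last exact: i1.
    by case/negP: ndx; apply: i2 xy.
  by move=> y x' dy cx'; apply: i2 => //; apply: (subsetP s1).
exists F, (fun x => top (m x)); split.
- by move=> x; split=> //; apply: sD (top_in _).
- move=> x y; rewrite leF => /initialP[s i]; split; first by apply/top_max/(subsetP s).
  move=> e; apply: (can_inj mK); apply: val_inj; apply/eqP; rewrite eqEsubset s /=.
  by apply/subsetP => z dz; apply: (i _ z (top_in _)) => //; rewrite e top_max.
- move=> p Dp; have ch := chain1 p set0 (or_introl erefl) Dp ltac:(by move=> x; rewrite inE).
  exists (h (mkN _ ch)); rewrite hK; apply: topE; rewrite ?setU11 //=.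
  move=> x; rewrite setU0 => /setU1P[->//|Bx]; exact: Bmin.
- move=> x p Dp le_xp; set c := m x in le_xp *.
  have le_p z : z \in val c -> le z p by move=> cz; apply: le_trans le_xp; apply: top_max.
  have ch := chain1 p (val c) (or_intror (Nch c)) Dp le_p.
  have Bc : B \subset val c by have [] := chainP (Nch c).
  exists (h (mkN _ ch)); last first.
    rewrite hK; apply: topE; rewrite ?setU11 //= (setUidPr Bc).
    by move=> z /setU1P[->//|]; apply: le_p.
  rewrite leF hK /= (setUidPr Bc); apply/initialP; split; first exact: subsetUr.
  move=> z y cz /setU1P[->|//] pz; suff -> : p = top c by [].
  apply: le_anti; rewrite // ?(sD c) //; apply: le_trans pz _; exact: top_max.
split.
  case/set0Pn => b Bb; have Db := subsetP BD _ Bb.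
  have ch := chain1 b set0 (or_introl erefl) Db ltac:(by move=> x; rewrite inE).
  exists (h (mkN _ ch)) => x; rewrite leF hK /= setU0.
  have Bb1 z : z \in B -> z = b.
    move=> Bz; apply: le_anti; rewrite ?(subsetP BD) //; apply: Bmin => //;
    exact: (subsetP BD).
  have BN : B \subset val (m x) by case: (chainP (Nch (m x))).
  apply/initialP; split.
    by rewrite subUset sub1set (subsetP BN).
  move=> z y Hz cy; have -> : z = b by case/setU1P: Hz => [//|/Bb1].
  move=> yb.
  have -> : y = b; last by rewrite setU11.
  by apply: le_anti => //; [apply: sD cy|apply: Bmin => //; apply: sD cy].
move=> Q' R G f Df f_mono labf.
(* A node [x] of [G] is sent to the chain of values of [f] on its lower cone, completed by [B]. The
   greatest element of this chain is [f x], so labels are respected. *)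
pose im x := [set f y | y in [pred y | fle y x]].
have imP x z : reflect (exists2 y, fle y x & z = f y) (z \in im x).
  by apply: (iffP imsetP) => -[y]; exists y.
have im_f x : f x \in im x by apply/imP; exists x => //; apply: fle_refl.
have im_ch x : chain (B :|: im x).
  have -> : B :|: im x = f x |: (B :|: im x).
    by apply/setP => z; rewrite !inE; case: eqP => // ->; rewrite im_f orbT.
  apply/and4P; split.
  - by rewrite setUCA subsetUl.
  - by rewrite !subUset sub1set Df BD; apply/subsetP => z /imP[y _ ->].
  - by apply/set0Pn; exists (f x); rewrite setU11.
  have cD z : z \in B :|: im x -> z \in D.
    by case/setUP => [|/imP[y _ ->//]]; apply/subsetP.
  have -> : f x |: (B :|: im x) = B :|: im x.
    by apply/setP => z; rewrite !inE; case: eqP => // ->; rewrite im_f orbT.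
  apply/forall_inP => y cy; apply/forall_inP => z cz.
  case/setUP: (cy) => [By|/imP[y' y'x ey]]; first by rewrite (Bmin By (cD _ cz)).
  case/setUP: (cz) => [Bz|/imP[z' z'x ez]]; first by rewrite (Bmin Bz (cD _ cy)) orbT.
  by rewrite ey ez; case/orP: (fle_cone_chain y'x z'x) => /f_mono->; rewrite ?orbT.
have top_im x (ch : chain (B :|: im x)) : top (mkN _ ch) = f x.
  apply: topE; first by rewrite /= inE im_f orbT.
  move=> z /= /setUP[Bz|/imP[y yx ->]]; [exact: Bmin|exact: f_mono].
exists (fun x => h (mkN _ (im_ch x))); split=> [x y xy|x]; last first.
  by rewrite labF hK top_im.
rewrite leF !hK /=; apply/initialP; split.
  apply: setUS; apply/subsetP => z /imP[u ux ->]; apply/imP; exists u => //.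
  exact: fle_trans xy.
move=> u v /setUP[Bu|/imP[u' u'x ->]] /setUP[Bv|/imP[v' v'y ->]] vu; rewrite !inE ?Bv //.
  have -> : f v' = u; last by rewrite Bu.
  by apply: le_anti => //; [exact: (subsetP BD)|exact: Bmin].
apply/orP; right; apply/imP.
case/orP: (fle_cone_chain v'y (fle_trans u'x xy)) => [v'u'|u'v'].
  by exists v' => //; apply: fle_trans u'x.
exists u' => //; apply: le_anti => //; exact: f_mono.
Qed.

End Unfold.

(** Recursion on depth: the datum of a node extends the one at its greatest strict predecessor, and
    transitivity of [ext] carries this to all predecessors. Minimal nodes take any valid datum. *)
Lemma forest_choice (Q P : Type) (F : forest Q) (valid : 'I_(fsize F) -> P -> Prop)
    (ext : 'I_(fsize F) -> 'I_(fsize F) -> P -> P -> Prop) :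
    (forall x, exists p, valid x p) ->
    (forall x p, valid x p -> ext x x p p) ->
    (forall x y z p q r, fle x y -> fle y z -> ext x y p q -> ext y z q r -> ext x z p r) ->
    (forall x y p, fle x y -> valid x p -> exists2 q, valid y q & ext x y p q) ->
  exists f, (forall x, valid x (f x)) /\ (forall x y, fle x y -> ext x y (f x) (f y)).
Proof.
move=> root ext_refl ext_trans step.
pose below (x : 'I_(fsize F)) := [set y | fle y x].
pose depth x := #|below x|.
have depth_lt x y : fle x y -> x != y -> depth x < depth y.
  move=> xy ne; apply: proper_card; apply/properP; split.
    by apply/subsetP => z; rewrite !inE => zx; apply: fle_trans xy.
  exists y; rewrite inE ?fle_refl //; apply: contraNN ne => yx.
  by apply/eqP; apply: fle_anti.
have key n : exists f, (forall x, depth x < n -> valid x (f x)) /\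
    (forall x y, fle x y -> depth y < n -> ext x y (f x) (f y)).
  elim: n => [|n [f [vf ef]]].
    have [f vf] := choice root; by exists f.
  (* Data of depth below [n] are kept, those of depth [n] are chosen now, deeper ones are not
     constrained yet. *)
  have /choice[f' Hf'] : forall y, exists p, if depth y < n then p = f y else
      depth y <= n -> valid y p /\ (forall x, fle x y -> x != y -> ext x y (f x) p).
    move=> y; case: ltnP => [_|ge_y]; first by exists (f y).
    have [e|ne] := eqVneq (below y :\ y) set0.
      have [p vp] := root y; exists p => _; split=> // x xy ne.
      by have: x \in below y :\ y; [rewrite !inE ne|rewrite e inE].
    have [|||z] := @chain_max _ (@fle _ F) (below y :\ y) _ _ _ ne.
    - exact: (@fle_trans _ F).
    - exact: (@fle_refl _ F).
    - by move=> u v; rewrite !inE => /andP[_ uy] /andP[_ vy]; apply: fle_cone_chain uy vy.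
    rewrite !inE => /andP[zy le_zy] maxz.
    have [lt_y|le_y] := ltnP n (depth y); first by exists (f y).
    have lt_z : depth z < n by apply: leq_trans le_y; apply: depth_lt.
    have [p vp ep] := step _ _ _ le_zy (vf _ lt_z).
    exists p => _; split=> // x xy ne_xy; apply: (ext_trans _ z _ _ (f z)) => //.
      by apply: maxz; rewrite !inE ne_xy.
    by apply: ef => //; apply: maxz; rewrite !inE ne_xy.
  exists f'; split=> [x|x y xy]; rewrite ltnS => le_n.
    by have := Hf' x; case: ltnP => [lt_n ->|_ /(_ le_n)[]//]; apply: vf.
  have [exy|ne] := eqVneq x y.
    rewrite -exy; apply: ext_refl.
    by rewrite exy; have := Hf' y; case: ltnP => [lt_n ->|_ /(_ le_n)[]//]; apply: vf.
  have lt_x : depth x < n by apply: leq_trans le_n; apply: depth_lt.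
  have := Hf' x; rewrite lt_x => ->; have := Hf' y.
  case: ltnP => [lt_n ->|_ /(_ le_n)[_ H]]; [exact: ef|exact: H].
have [f [vf ef]] := key (\max_x depth x).+1.
by exists f; split=> [x|x y xy]; [apply: vf|apply: ef]; rewrite // ltnS leq_bigmax.
Qed.

(** * Embeddings of forests into automata *)

Section Nodes.
Variables (k : nat) (F : FTk k).

(** The inner nodes of all labels together; [tag] recovers the outer node. The order [nle] compares
    only nodes of the same inner tree, the outer order being used through [tag]. *)
Definition node := {x : 'I_(fsize F) & 'I_(fsize (proj1_sig (flab x)))}.
Definition mknode x s : node := @Tagged _ x (fun x => 'I_(fsize (proj1_sig (flab x)))) s.
Definition nlab (n : node) : 'I_k := flab (tagged n).
Definition nle : rel node :=
  fun u v => (tag u == tag v) && fle (tagged u) (tagged_as u v).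

Lemma nle_mknode x (s t : 'I_(fsize (proj1_sig (flab x)))) :
  nle (mknode s) (mknode t) = fle s t.
Proof. by rewrite /nle eqxx tagged_asE. Qed.

Lemma nle_tag u v : nle u v -> tag u = tag v.
Proof. by case/andP=> /eqP. Qed.

Lemma nleP u v : nle u v -> exists x s t, [/\ u = @mknode x s, v = mknode t & fle s t].
Proof.
case: u v => [x s] [y t] uv; have /= e := nle_tag uv; subst y.
by exists x, s, t; split=> //; rewrite -nle_mknode.
Qed.

Lemma nle_refl : reflexive nle.
Proof. by case=> x s; rewrite nle_mknode fle_refl. Qed.

Lemma nle_trans : transitive nle.
Proof.
case=> y t [x s] [z r] uv vw; have /= exy := nle_tag uv; have /= eyz := nle_tag vw.
subst y z; move: uv vw; rewrite !nle_mknode; exact: fle_trans.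
Qed.

Lemma nle_anti u v : nle u v -> nle v u -> u = v.
Proof.
case: u v => [x s] [y t] uv; have /= e := nle_tag uv; subst y.
move: uv; rewrite !nle_mknode => st ts; congr (mknode _); exact: fle_anti.
Qed.

Lemma nle_cone_chain u v w : nle v u -> nle w u -> nle v w || nle w v.
Proof.
case: u v w => [x s] [y t] [z r] vu wu.
have /= e := nle_tag vu; have /= e' := nle_tag wu; subst y z.
move: vu wu; rewrite !nle_mknode; exact: fle_cone_chain.
Qed.

Lemma nle_root x : exists2 r : node, tag r = x & forall u, tag u = x -> nle r u.
Proof.
have [r rP] := proj2_sig (flab x); exists (mknode r) => // -[y t] /= e; subst y.
by rewrite nle_mknode.
Qed.

End Nodes.

(** * Embeddings and the greatest embeddable forest *)

Section Embeddings.
Variables (X : Type) (k : nat) (M : automaton X) (col : {set state M} -> 'I_k).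
Implicit Types (S C : {set state M}).

(** Between cycles one pair of states is as good as all pairs, by strong connectedness. *)
Definition reachS S C := exists p q, [/\ p \in S, q \in C & reach p q].

Definition embeds (F : FTk k) (Mo : 'I_(fsize F) -> {set state M})
    (m : node F -> {set state M}) :=
  [/\ forall x, cyc (Mo x), forall n, cyc (m n) /\ m n \subset Mo (tag n),
      forall u v, nle u v -> m v \subset m u, forall n, col (m n) = nlab n
    & forall x y, fle x y -> reachS (Mo x) (Mo y)].

(** What a simulation needs from the source embedding: every cycle is the image of a node, and every
    later or smaller cycle is met further on. The last clause makes a return to a cycle, among
    comparable nodes, a return to its node. *)
Definition complete (F : FTk k) (Mo : 'I_(fsize F) -> {set state M})
    (m : node F -> {set state M}) :=
  [/\ forall S, cyc S -> exists n, m n = S,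
      forall x S, cyc S -> reachS (Mo x) S -> exists2 n, fle x (tag n) & m n = S,
      forall x S, cyc S -> S \subset Mo x -> exists2 n, tag n = x & m n = S,
      forall u S, cyc S -> S \subset m u -> exists2 v, nle u v & m v = S
    & forall u v, nle u v -> m u = m v -> u = v].

Definition embeddable F := exists Mo m, @embeds F Mo m.

Lemma leF_embeddable F G : leF G F -> embeddable F -> embeddable G.
Proof.
case=> phi [phi_mono labphi] [Mo [m [cM cm mm colm rM]]].
pose psi x := projT1 (cid (labphi x)).
have [psi_mono labpsi] : (forall x s t, fle s t -> fle (psi x s) (psi x t)) /\
    (forall x s, flab s = flab (psi x s)).
  by split=> x; rewrite /psi; case: (cid _) => f /= [].
exists (Mo \o phi), (fun n => m (mknode (psi (tag n) (tagged n)))); split.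
- by move=> x; apply: cM.
- by move=> n; have [? ?] := cm (mknode (psi (tag n) (tagged n))); split.
- by move=> u v /nleP[x [s [t [-> -> st]]]]; apply: mm; rewrite nle_mknode psi_mono.
- by move=> n; rewrite colm /nlab /= -labpsi.
- by move=> x y /phi_mono/rM.
Qed.

Lemma reachS_trans S C C' : cyc C -> reachS S C -> reachS C C' -> reachS S C'.
Proof.
move=> [_ _ conn] [p [q [Sp Cq pq]]] [p' [q' [Cp' Cq' pq']]].
exists p, q'; split=> //; apply: reach_trans pq _; apply: reach_trans pq'.
by have [u [_ _ <-]] := conn _ _ Cq Cp'; exists u.
Qed.

Lemma cyc_reach S p q : cyc S -> p \in S -> q \in S -> reach p q.
Proof. by case=> _ _ conn Sp /(conn _ _ Sp)[u [_ _ <-]]; exists u. Qed.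

(** When [s] lies on a cycle, this is the largest cycle through [s]. *)
Definition scc (s : state M) : {set state M} := [set r | `[<reach s r /\ reach r s>]].

Lemma sccP s r : reflect (reach s r /\ reach r s) (r \in scc s).
Proof. by rewrite inE; apply: asboolP. Qed.

Lemma cyc_scc S s : cyc S -> s \in S -> cyc (scc s).
Proof.
move=> cS Ss; have [_ initS conn] := cS.
have ss : s \in scc s by apply/sccP; split; apply: reach_refl.
split; first by exists s.
  by move=> q /sccP[sq _]; apply: reach_trans (initS _ Ss) sq.
move=> p q /sccP[[u up] [u' eu']] /sccP[[v ev] qs].
have [w [w0 _ ew]] := conn _ _ Ss Ss.
exists (u' ++ w ++ v); split; first by case: (u') w0 => //; case: (w).
  apply/withinP => r vr; apply/sccP.
  have rE: ftrans p (u' ++ w ++ v) = q by rewrite !ftrans_cat eu' ew.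
  split; first by apply: reach_trans (reach_vis vr); exists u.
  by apply: reach_trans (vis_reach vr) _; rewrite rE.
by rewrite !ftrans_cat eu' ew.
Qed.

Lemma sub_scc S s : cyc S -> s \in S -> S \subset scc s.
Proof. by move=> cS Ss; apply/subsetP => r Sr; apply/sccP; split; apply: cyc_reach cS _ _. Qed.

(** Unfolds the subcycles of [C] under reverse inclusion. The base [[set C]] makes the unfolding a
    tree, and the lifting property of chains makes it the greatest. *)
Lemma cycle_tree C : cyc C ->
  exists (T : Tk k) (m : 'I_(fsize (proj1_sig T)) -> {set state M}),
    [/\ forall s, [/\ cyc (m s), m s \subset C & col (m s) = flab s],
        forall s t, fle s t -> m t \subset m s /\ (m s = m t -> s = t),
        forall S, cyc S -> S \subset C -> exists s, m s = S,
        forall s S, cyc S -> S \subset m s -> exists2 t, fle s t & m t = S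
      & forall (T' : Tk k) (f : 'I_(fsize (proj1_sig T')) -> {set state M}),
        (forall s, [/\ cyc (f s), f s \subset C & col (f s) = flab s]) ->
        (forall s t, fle s t -> f t \subset f s) -> leT T' T].
Proof.
move=> cC; pose D := [set S : {set state M} | `[<cyc S>] & S \subset C].
have DP S : reflect (cyc S /\ S \subset C) (S \in D).
  by rewrite inE; apply: (iffP andP) => -[/asboolP].
have DC : C \in D by apply/DP.
have [||||||F [m [mD m_mono m_cover m_ext [m_tree m_lift]]]] :=
    @chain_unfolding _ D [set C] (fun S S' => S' \subset S) _ col.
- by move=> S /=.
- by move=> S S' S'' s1 s2; apply: subset_trans s1.
- by move=> S S' _ _ s1 s2; apply/eqP; rewrite eqEsubset s1 s2.
- by rewrite sub1set.
- by move=> S S' /set1P-> /DP[].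
- by apply/set0Pn; exists C.
have F_tree : is_tree F by apply: m_tree; apply/set0Pn; exists C; rewrite inE.
exists (exist _ F F_tree), m; split=> /=.
- by move=> s; have [/DP[? ?] ->] := mD s.
- exact: m_mono.
- by move=> S cS SC; apply: m_cover; apply/DP.
- move=> s S cS Ss; apply: m_ext => //; apply/DP; split=> //.
  by apply: subset_trans Ss _; have [/DP[]] := mD s.
move=> T' f fP f_anti; apply: (m_lift _ _ _ f) => [s||s].
  by apply/DP; have [] := fP s; split.
  exact: f_anti.
by have [_ _ ->] := fP s.
Qed.

(** Unfolds the strongly connected components under reachability and labels each with its cycle
    tree. The base is empty because no component need be least. *)
Lemma cycle_forest (x0 : X) : exists F Mo m, [/\ @embeds F Mo m, complete Mo m &
  forall G, embeddable G -> leF G F].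
Proof.
(* This cycle makes the forest nonempty and provides a default tree for sets that are not cycles. *)
have cyc0 := cyc_infset M (fun=> x0).
pose tree_of C (T : Tk k) := exists m : 'I_(fsize (proj1_sig T)) -> {set state M},
    [/\ forall s, [/\ cyc (m s), m s \subset C & col (m s) = flab s],
        forall s t, fle s t -> m t \subset m s /\ (m s = m t -> s = t),
        forall S, cyc S -> S \subset C -> exists s, m s = S,
        forall s S, cyc S -> S \subset m s -> exists2 t, fle s t & m t = S
      & forall (T' : Tk k) (f : 'I_(fsize (proj1_sig T')) -> {set state M}),
        (forall s, [/\ cyc (f s), f s \subset C & col (f s) = flab s]) ->
        (forall s t, fle s t -> f t \subset f s) -> leT T' T].
have /choice[T TP] : forall C, exists T, cyc C -> tree_of C T.
  move=> C; have [cC|nC] := pselect (cyc C).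
    by have [T [m ?]] := cycle_tree cC; exists T => _; exists m.
  by have [T _] := cycle_tree cyc0; exists T.
pose D := [set C : {set state M} | `[<exists2 s, cyc C & C = scc s>]].
have DP C : reflect (exists2 s, cyc C & C = scc s) (C \in D) by rewrite inE; apply: asboolP.
have D_cyc C : C \in D -> cyc C by case/DP.
have D_sup S : cyc S -> exists2 C, C \in D & S \subset C.
  move=> cS; have [[s Ss] _ _] := cS; exists (scc s); last exact: sub_scc.
  by apply/DP; exists s => //; apply: cyc_scc Ss.
(* The equality disjunct makes [le] reflexive on all sets of states, as the unfolding requires, and
   not only on cycles. *)
pose le C C' := (C == C') || `[<[/\ cyc C, cyc C' & reachS C C']>].
have leP C C' : cyc C -> cyc C' -> le C C' <-> reachS C C'.
  move=> cC cC'; split; last by move=> h; apply/orP; right; apply/asboolP.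
  case/orP=> [/eqP<-|/asboolP[]//]; have [[s Cs] _ _] := cC.
  by exists s, s; split=> //; apply: reach_refl.
have [|||||F [Mo [MoD Mo_mono Mo_cover Mo_ext [_ Mo_lift]]]] :=
    @chain_unfolding _ D set0 le _ T (fun C => ltac:(by rewrite /le eqxx)).
- move=> C' C C'' h1 h2.
  have [->//|ne1] := eqVneq C C'; have [<-//|ne2] := eqVneq C' C''.
  case/orP: h1 => [/eqP/(elimN eqP ne1)//|/asboolP[c1 c2 r1]].
  case/orP: h2 => [/eqP/(elimN eqP ne2)//|/asboolP[_ c3 r2]].
  by apply/leP => //; apply: reachS_trans r1 r2.
- move=> C C' DC DC' /leP h1 /leP h2.
  have {h1} [p [q [Cp Cq pq]]] := h1 (D_cyc _ DC) (D_cyc _ DC').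
  have {h2} [q' [p' [Cq' Cp' qp]]] := h2 (D_cyc _ DC') (D_cyc _ DC).
  have {}qp : reach q p.
    apply: reach_trans (cyc_reach (D_cyc _ DC') Cq Cq') _.
    by apply: reach_trans qp _; apply: cyc_reach (D_cyc _ DC) _ _.
  case/DP: DC Cp {Cp'} => s _ -> /sccP[sp ps].
  case/DP: DC' Cq {Cq'} => s' _ -> /sccP[sq qs].
  have ss : reach s s' := reach_trans sp (reach_trans pq qs).
  have ss' : reach s' s := reach_trans sq (reach_trans qp ps).
  apply/setP => r; apply/sccP/sccP => -[h1 h2].
    by split; [apply: reach_trans h1|apply: reach_trans ss].
  by split; [apply: reach_trans h1|apply: reach_trans ss'].
- exact: sub0set.
- by move=> b C; rewrite inE.
- by have [C DC _] := D_sup _ cyc0; apply/set0Pn; exists C.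
have cMo x : cyc (Mo x) by have [/D_cyc] := MoD x.
have TF x : tree_of (Mo x) (flab x) by have [_ ->] := MoD x; apply: TP.
pose mm x := projT1 (cid (TF x)).
have mmP x : [/\ forall s, [/\ cyc (mm x s), mm x s \subset Mo x & col (mm x s) = flab s],
        forall s t, fle s t -> mm x t \subset mm x s /\ (mm x s = mm x t -> s = t),
        forall S, cyc S -> S \subset Mo x -> exists s, mm x s = S,
        forall s S, cyc S -> S \subset mm x s -> exists2 t, fle s t & mm x t = S
      & forall (T' : Tk k) (f : 'I_(fsize (proj1_sig T')) -> {set state M}),
        (forall s, [/\ cyc (f s), f s \subset Mo x & col (f s) = flab s]) ->
        (forall s t, fle s t -> f t \subset f s) -> leT T' (flab x)].
  exact: projT2 (cid (TF x)).
have inner x S : cyc S -> S \subset Mo x ->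
    exists2 n : node F, tag n = x & mm (tag n) (tagged n) = S.
  have [_ _ cover _ _] := mmP x => cS sub; have [s es] := cover _ cS sub.
  by exists (mknode s).
exists F, Mo, (fun n => mm (tag n) (tagged n)); split; first split.
- by [].
- by move=> n; have [/(_ (tagged n))[? ? _] _ _ _ _] := mmP (tag n); split.
- by move=> u v /nleP[x [s [t [-> -> st]]]] /=; have [_ /(_ _ _ st)[? _] _ _ _] := mmP x.
- by move=> n; have [/(_ (tagged n))[_ _ ->]] := mmP (tag n).
- by move=> x y /Mo_mono[h _]; apply/leP.
- split=> //.
  + move=> S cS; have [C DC sub] := D_sup _ cS; have [x ex] := Mo_cover _ DC.
    by have [|n _ en] := inner x S cS; [rewrite ex|exists n].
  + move=> x S cS r; have [C DC sub] := D_sup _ cS.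
    have [|y xy ey] := Mo_ext x C DC.
      apply/leP => //; first exact: D_cyc.
      have [p [q [? ? ?]]] := r; exists p, q; split=> //; exact: (subsetP sub).
    by have [|n tn en] := inner y S cS; [rewrite ey|exists n; rewrite ?tn].
  + move=> [x s] S cS /= sub; have [_ _ _ ext _] := mmP x.
    by have [t st et] := ext _ _ cS sub; exists (mknode t); rewrite ?nle_mknode.
  + move=> u v /nleP[x [s [t [-> -> st]]]] /= e; have [_ inj _ _ _] := mmP x.
    by rewrite ((inj _ _ st).2 e).
move=> G [Mo' [m' [cM' cm' mm' col' rM']]].
(* An outer cycle of [G] is enlarged to a component containing it; its inner cycles then lie in that
   component, whose tree is universal. *)
have /choice[f fP] : forall x, exists C, C \in D /\ Mo' x \subset C.
  by move=> x; have [C DC sub] := D_sup _ (cM' x); exists C.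
apply: (Mo_lift _ _ _ f) => [x|x y /rM' r|x]; first by have [] := fP x.
  have [DC sub] := fP x; have [DC' sub'] := fP y; apply/leP; try exact: D_cyc.
  have [p [q [? ? ?]]] := r; exists p, q.
  by split=> //; [exact: (subsetP sub)|exact: (subsetP sub')].
have [DC sub] := fP x; have [_ _ _ _ lift] := projT2 (cid (TP _ (D_cyc _ DC))).
apply: (lift _ (fun s => m' (mknode s))) => [s|s t st].
  have [? s'] := cm' (mknode s); split=> //.
  exact: subset_trans sub.
by apply: mm'; rewrite nle_mknode.
Qed.

End Embeddings.

(** * Transporting embeddings along continuous reductions *)

Section Reduction.
Variables (X : Type) (A B : automaton X) (g : word X -> word X).
Hypothesis cont_g : cantor_continuous g.
Implicit Types (S C : {set state A}) (u v w a b : seq X).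

Definition determines w v := forall xi, pre w xi -> pre v (g xi).

Definition shadow S w v : {set state B} :=
  [set r | `[<exists a b, [/\ within S (at_ A w) a, determines (w ++ a) (v ++ b)
                          & r = at_ B (v ++ b)]>]].

(** Extensions within [S] can only shrink the shadow, so this says that it has become constant. *)
Definition settled S w v := [/\ determines w v, at_ A w \in S & forall a b,
  within S (at_ A w) a -> determines (w ++ a) (v ++ b) ->
  shadow S w v \subset shadow S (w ++ a) (v ++ b)].

Lemma shadowP S w v r : reflect (exists a b, [/\ within S (at_ A w) a,
    determines (w ++ a) (v ++ b) & r = at_ B (v ++ b)]) (r \in shadow S w v).
Proof. by rewrite inE; apply: asboolP. Qed.

Lemma determines_cat w v a : determines w v -> determines (w ++ a) v.
Proof. by move=> det xi /pre_catl/det. Qed.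

Lemma shadow_ext S C w v a b : S \subset C -> within C (at_ A w) a ->
  shadow S (w ++ a) (v ++ b) \subset shadow C w v.
Proof.
move=> SC wa; apply/subsetP => r /shadowP[a' [b' [wa' det ->]]].
apply/shadowP; exists (a ++ a'), (b ++ b'); rewrite within_cat wa !catA -at_cat.
by split=> //; apply: within_sub wa'.
Qed.

(** Shadows are finite, so an extension that minimizes the cardinality of the shadow is settled. *)
Lemma settle S w v : determines w v -> at_ A w \in S ->
  exists a b, within S (at_ A w) a /\ settled S (w ++ a) (v ++ b).
Proof.
move=> det Sw.
pose P n := `[<exists a b, [/\ within S (at_ A w) a, determines (w ++ a) (v ++ b)
  & #|shadow S (w ++ a) (v ++ b)| = n]>].
have exP : exists n, P n.
  exists #|shadow S w v|; apply/asboolP; exists [::], [::].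
  by rewrite !cats0 within_nil.
case: (ex_minnP exP) => n /asboolP[a [b [wa deta <-]]] min_n.
exists a, b; split=> //; split=> //; first by rewrite at_cat; apply: within_last.
move=> a' b' wa' det'.
have sub : shadow S ((w ++ a) ++ a') ((v ++ b) ++ b') \subset shadow S (w ++ a) (v ++ b).
  exact: shadow_ext.
rewrite -(geq_leqif (subset_leqif_card sub)); apply: min_n; apply/asboolP.
exists (a ++ a'), (b ++ b'); rewrite !catA within_cat wa -at_cat.
by split.
Qed.

Lemma settled_ext S w v a b : settled S w v -> within S (at_ A w) a ->
  determines (w ++ a) (v ++ b) ->
  settled S (w ++ a) (v ++ b) /\ shadow S (w ++ a) (v ++ b) = shadow S w v.
Proof.
move=> [det Sw min] wa deta.
have e : shadow S (w ++ a) (v ++ b) = shadow S w v.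
  by apply/eqP; rewrite eqEsubset shadow_ext // min.
split=> //; split=> //; first by rewrite at_cat; apply: within_last.
move=> a' b' wa' det'; rewrite e -!catA; apply: min; rewrite ?catA //.
by rewrite within_cat wa -at_cat.
Qed.

Lemma tour_forever S w : cyc S -> at_ A w \in S ->
  exists xi, pre w xi /\ forall n, within S (at_ A w) (mkseq (shift (size w) xi) n).
Proof.
move=> cS Sw; have [u [u0 wu _ eu]] := tour cS Sw Sw.
pose W n := w ++ flatten (nseq n u).
have Wcat n : W n.+1 = W n ++ u.
  by rewrite /W -addn1 nseqD flatten_cat /= cats0 catA.
have Wsize n : n <= size (flatten (nseq n u)).
  elim: n => [//|n IHn] /=; rewrite size_cat -add1n leq_add //.
  by case: (u) u0.
have Wbig n : exists m, n <= size (W m).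
  by exists n; rewrite size_cat; apply: leq_trans (leq_addl _ _).
have [xi pxi] := chain_limit Wcat Wbig.
exists xi; split; first by have := pxi 0; rewrite /W cats0.
move=> n; have /pre_catr := pxi n; rewrite /pre => e.
have wW m : within S (at_ A w) (flatten (nseq m u)) /\
    ftrans (at_ A w) (flatten (nseq m u)) = at_ A w.
  elim: m => [|m [IH1 IH2]]; first by rewrite within_nil.
  by rewrite /= within_cat wu ftrans_cat eu IH1.
have [+ _] := wW n; rewrite -e -(subnKC (Wsize n)) mkseqD within_cat.
by case/andP.
Qed.

(** Continuity at an infinite input that stays in [S] forces a finite part of it to determine one
    more output letter. *)
Lemma determine_longer S w v : cyc S -> settled S w v ->
  exists a b, [/\ within S (at_ A w) a, determines (w ++ a) (v ++ b) & b <> [::]].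
Proof.
move=> cS [det Sw _]; have [xi [pxi wxi]] := tour_forever cS Sw.
have [m Hm] := cont_g xi (size v).+1.
pose a := mkseq (shift (size w) xi) m.
have ewa : w ++ a = mkseq xi (size w + m) by rewrite mkseqD pxi.
exists a, [:: g xi (size v)]; split; [exact: wxi|move=> eta|by []].
rewrite ewa {1}/pre size_mkseq => e.
have /agreeP : agree (size v).+1 (g xi) (g eta).
  apply: Hm => i lt_i; have /agreeP : mkseq eta (size w + m) = mkseq xi (size w + m) by [].
  by move/(_ i) => ->//; apply: leq_trans lt_i (leq_addl _ _).
by rewrite /pre size_cat addn1 /= => <-; rewrite mkseqS (det _ pxi) cats1.
Qed.

(** One round: the input tours [S] while the output visits the whole shadow, every state of which
    remains attainable because the pair is settled. *)
Lemma settled_step S w v : cyc S -> settled S w v ->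
  exists a b, [/\ within S (at_ A w) a /\ {subset S <= vis (at_ A w) a},
    a <> [::], b <> [::], determines (w ++ a) (v ++ b)
  & {subset shadow S w v <= vis (at_ B v) b}].
Proof.
move=> cS st; have [det Sw _] := st.
have [a0 [a0n wa0 sa0 _]] := tour cS Sw Sw.
have [st0 e0] := settled_ext (b := [::]) st wa0 ltac:(by rewrite cats0; apply: determines_cat).
rewrite cats0 in st0 e0.
(* Secures a nonempty output before any state of the shadow is sought. *)
have [a1 [b1 [wa1 det1 b1n]]] := determine_longer cS st0.
have key (s : seq (state B)) : {subset s <= shadow S w v} ->
    exists a b, [/\ within S (at_ A (w ++ a0)) a, b <> [::],
      determines ((w ++ a0) ++ a) (v ++ b) & {subset s <= vis (at_ B v) b}].
  elim: s => [|r s IHs] sub; first by exists a1, b1; split.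
  have [a [b [wa bn deta sb]]] := IHs (fun x sx => sub x (mem_behead (s := r :: s) sx)).
  have [_ e] := settled_ext st0 wa deta.
  have /shadowP[a' [b' [wa' det' er]]] : r \in shadow S ((w ++ a0) ++ a) (v ++ b).
    by rewrite e e0 sub ?mem_head.
  exists (a ++ a'), (b ++ b'); split; rewrite ?within_cat ?wa -?at_cat ?catA //.
    by case: (b) bn.
  move=> x; rewrite inE vis_cat => /predU1P[->|/sb->//].
  by rewrite er !at_cat vis_last orbT.
have [|a [b [wa bn deta sb]]] := key (enum (shadow S w v)).
  by move=> x; rewrite mem_enum.
exists (a0 ++ a), b; rewrite catA within_cat wa0 -at_cat; split=> //.
- by split=> // x /sa0; rewrite vis_cat => ->.
- by case: (a0) a0n.
- by move=> x xs; apply: sb; rewrite mem_enum.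
Qed.

(** Iterating the rounds yields an input with limit set [S] whose image has the shadow as limit
    set. *)
Lemma settled_realize S w v : cyc S -> settled S w v ->
  exists xi, inf_states xi S /\ inf_states (g xi) (shadow S w v).
Proof.
move=> cS st0; set V := shadow S w v.
pose T := (seq X * seq X)%type.
have /choice[step stepP] : forall p : T, exists q : T,
    settled S p.1 p.2 -> [/\ within S (at_ A p.1) q.1 /\ {subset S <= vis (at_ A p.1) q.1},
    q.1 <> [::], q.2 <> [::], determines (p.1 ++ q.1) (p.2 ++ q.2)
  & {subset shadow S p.1 p.2 <= vis (at_ B p.2) q.2}].
  case=> w1 v1; have [st|nst] := pselect (settled S w1 v1); last by exists ([::], [::]).
  by have [a [b H]] := settled_step cS st; exists (a, b).
pose st n := iter n (fun p : T => (p.1 ++ (step p).1, p.2 ++ (step p).2)) (w, v).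
have stP n : settled S (st n).1 (st n).2 /\ shadow S (st n).1 (st n).2 = V.
  elim: n => [//|n [IH e]] /=; have [[wa _] _ _ det _] := stepP _ IH.
  by have := settled_ext IH wa det; rewrite e.
have nonempty (s : seq X) : s <> [::] -> 0 < size s by case: s.
have big1 n : n <= size (st n).1.
  elim: n => [//|n IHn] /=; rewrite size_cat -addn1 leq_add //.
  by have [+ _] := stP n => /stepP[_ /nonempty].
have big2 n : n <= size (st n).2.
  elim: n => [//|n IHn] /=; rewrite size_cat -addn1 leq_add //.
  by have [+ _] := stP n => /stepP[_ _ /nonempty].
have [xi pxi] := @chain_limit _ (fun n => (st n).1) (fun n => (step (st n)).1)
  (fun n => erefl) (fun n => ex_intro _ n (big1 n)).
(* Intermediate target states lie in the shadow too: a prefix of a determined output is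
   determined. *)
have inter n : within V (at_ B (st n).2) (step (st n)).2.
  have [IH <-] := stP n; have [[wa _] _ _ det _] := stepP _ IH.
  apply/withinP => r /visP[i le_i ->]; apply/shadowP.
  exists (step (st n)).1, (take i (step (st n)).2); rewrite at_cat; split=> //.
  by move=> eta /det; rewrite -{1}(cat_take_drop i (step (st n)).2) catA => /pre_catl.
exists xi; split.
  apply: (@inf_blocks _ A xi (fun n => (st n).1) (fun n => (step (st n)).1) S 0) => //.
  - by move=> n; exists n.
  - by move=> n _; have [+ _] := stP n => /stepP[[]].
  - by move=> q n Sq; exists n => //; have [+ _] := stP n => /stepP[[_ sub] _ _ _ _]; apply: sub.
apply: (@inf_blocks _ B (g xi) (fun n => (st n).2) (fun n => (step (st n)).2) V 0) => //.
- by move=> n; exists n.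
- by move=> n; have [[det _ _] _] := stP n; apply: det.
- move=> q n Vq; exists n => //; have [IH e] := stP n.
  by have [_ _ _ _ sub] := stepP _ IH; apply: sub; rewrite e.
Qed.

Lemma cyc_shadow S w v : cyc S -> settled S w v -> cyc (shadow S w v).
Proof.
move=> cS st; have [xi [_ /inf_states_infset->]] := settled_realize cS st.
exact: cyc_infset.
Qed.

Lemma shadow_base S w v : settled S w v -> at_ B v \in shadow S w v.
Proof.
by case=> det Sw _; apply/shadowP; exists [::], [::]; rewrite !cats0 within_nil.
Qed.

Variables (k : nat) (colA : {set state A} -> 'I_k) (colB : {set state B} -> 'I_k).
Variables (LA LB : kpartition X k).
Hypotheses (hA : colored LA colA) (hB : colored LB colB).
Hypothesis gP : forall xi, LA xi = LB (g xi).

Lemma color_shadow S w v : cyc S -> settled S w v -> colB (shadow S w v) = colA S.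
Proof.
move=> cS st; have [xi [iA iB]] := settled_realize cS st.
by rewrite -(hA iA) -(hB iB).
Qed.

(** Each cycle of the embedding is replaced by the shadow of a settled pair; the pairs are chosen
    coherently, first along the outer forest and then inside each inner tree. *)
Lemma embeddable_reduction F : embeddable colA F -> embeddable colB F.
Proof.
case=> Mo [m [cM cm mm colm rM]]; pose T := (seq X * seq X)%type.
(* Outer pairs extend one another only on the output side here: this is what reachability in [B]
   needs. *)
have [] := @forest_choice _ T F (fun x p => settled (Mo x) p.1 p.2)
    (fun _ _ p q => exists b, q.2 = p.2 ++ b).
- move=> x; have [[q Mq] /(_ q) [//|w ew] _] := cM x.
  have [|a [b [_ st]]] := @settle (Mo x) w [::] (fun xi _ => pre0 xi).
    by rewrite /at_ ew.
  by exists (w ++ a, b).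
- by move=> x p _; exists [::]; rewrite cats0.
- by move=> x y z p q r _ _ [b ->] [b' ->]; exists (b ++ b'); rewrite catA.
- move=> x y [w v] /rM[p [q [Mp Mq [c ec]]]] [/= det Mw _].
  have [c' ec'] := cyc_reach (cM x) Mw Mp.
  have [||a [b [_ st]]] := @settle (Mo y) (w ++ c' ++ c) v.
  + exact: determines_cat.
  + by rewrite at_cat ftrans_cat ec' ec.
  by exists ((w ++ c' ++ c) ++ a, v ++ b) => //; exists b.
move=> base [baseP baseE].
(* Inner pairs start from the outer pair and stay in [Mo x]; later ones stay in the cycle of the
   earlier node. Then [shadow_ext] gives the required inclusions. *)
have inner x := @forest_choice _ T (proj1_sig (flab x)) (fun s p =>
    settled (m (mknode s)) p.1 p.2 /\ exists a b, [/\ within (Mo x) (at_ A (base x).1) a,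
      p.1 = (base x).1 ++ a & p.2 = (base x).2 ++ b])
    (fun s t p q => exists a b, [/\ within (m (mknode s)) (at_ A p.1) a,
      q.1 = p.1 ++ a & q.2 = p.2 ++ b]).
have {inner} innerP x : exists f : 'I_(fsize (proj1_sig (flab x))) -> T,
   (forall s, settled (m (mknode s)) (f s).1 (f s).2 /\
      exists a b, [/\ within (Mo x) (at_ A (base x).1) a,
      (f s).1 = (base x).1 ++ a & (f s).2 = (base x).2 ++ b]) /\
   (forall s t, fle s t -> exists a b, [/\ within (m (mknode s)) (at_ A (f s).1) a,
      (f t).1 = (f s).1 ++ a & (f t).2 = (f s).2 ++ b]).
  apply: inner.
  - move=> s; have [[[q mq] _ _] sub] := cm (mknode s); have [det Mw _] := baseP x.
    have [u [_ wu _ eu]] := tour (cM x) Mw (subsetP sub _ mq).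
    have [||a [b [wa st]]] := @settle (m (mknode s)) ((base x).1 ++ u) (base x).2.
    + exact: determines_cat.
    + by rewrite at_cat eu.
    exists (((base x).1 ++ u) ++ a, (base x).2 ++ b); split=> //.
    exists (u ++ a), b; rewrite within_cat wu catA -at_cat; split=> //.
    exact: within_sub wa.
  - move=> s p [[_ Sp _] _]; exists [::], [::]; rewrite !cats0.
    by rewrite within_nil.
  - move=> s t r p q p' st tr [a [b [wa e1 e2]]] [a' [b' [wa' e1' e2']]].
    exists (a ++ a'), (b ++ b'); rewrite e1' e2' e1 e2 !catA within_cat wa -at_cat -e1.
    split=> //; apply: within_sub wa'; apply: mm; by rewrite nle_mknode.
  - move=> s t [w v] st [[/= det Sw _] [a0 [b0 [wa0 e1 e2]]]].
    have [cs subs] := cm (mknode s); have [[[q mq] _ _] subt] := cm (mknode t).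
    have sub : m (mknode t) \subset m (mknode s) by apply: mm; rewrite nle_mknode.
    have [u [_ wu _ eu]] := tour cs Sw (subsetP sub _ mq).
    have [||a [b [wa sta]]] := @settle (m (mknode t)) (w ++ u) v.
    + exact: determines_cat.
    + by rewrite at_cat eu.
    have wua : within (m (mknode s)) (at_ A w) (u ++ a).
      by rewrite within_cat wu -at_cat; apply: within_sub wa.
    exists ((w ++ u) ++ a, v ++ b); last by exists (u ++ a), b; rewrite catA.
    split=> //; exists (a0 ++ u ++ a), (b0 ++ b); rewrite /= !catA -e1 -e2 -catA.
    rewrite within_cat wa0 -at_cat -e1 -catA; split=> //.
    exact: within_sub wua.
pose f x := projT1 (cid (innerP x)).
have fP x : (forall s, settled (m (mknode s)) (f x s).1 (f x s).2 /\
      exists a b, [/\ within (Mo x) (at_ A (base x).1) a,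
      (f x s).1 = (base x).1 ++ a & (f x s).2 = (base x).2 ++ b]) /\
   (forall s t, fle s t -> exists a b, [/\ within (m (mknode s)) (at_ A (f x s).1) a,
      (f x t).1 = (f x s).1 ++ a & (f x t).2 = (f x s).2 ++ b]).
  exact: projT2 (cid (innerP x)).
exists (fun x => shadow (Mo x) (base x).1 (base x).2),
  (fun n => shadow (m n) (f (tag n) (tagged n)).1 (f (tag n) (tagged n)).2); split.
- by move=> x; apply: cyc_shadow.
- move=> [x s] /=; have [/(_ s)[st [a [b [wa e1 e2]]]] _] := fP x.
  have [cs sub] := cm (mknode s); split; first exact: cyc_shadow cs st.
  by rewrite e1 e2; apply: shadow_ext.
- move=> u v /nleP[x [s [t [-> -> st]]]] /=; have [_ /(_ _ _ st)[a [b [wa -> ->]]]] := fP x.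
  by apply: shadow_ext => //; apply: mm; rewrite nle_mknode.
- move=> [x s] /=; have [/(_ s)[st _] _] := fP x.
  rewrite color_shadow ?colm //; by have [] := cm (mknode s).
- move=> x y xy; exists (at_ B (base x).2), (at_ B (base y).2).
  split; try exact: shadow_base.
  by have [b ->] := baseE _ _ xy; exists b; rewrite at_cat.
Qed.

End Reduction.

(** * Simulating an automaton by another one *)

Section Loops.
Variables (X : Type) (M : automaton X).
Implicit Types (w : seq X) (xi : word X) (S : {set state M}).

(* The set of states met since the previous visit to the current state. *)
Definition loop w : option {set state M} :=
  let r i := at_ M (take i w) in
  omap (fun j : 'I_(size w) =>
          [set p | [exists i : 'I_(size w).+1, (j <= i) && (r i == p)]])
    [pick j : 'I_(size w) | (r j == r (size w)) &&
       [forall i : 'I_(size w), (j < i) ==> (r i != r (size w))]].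

Variant loop_spec xi n : option {set state M} -> Prop :=
| NoLoop of (forall j, j < n -> run M xi j <> run M xi n) : loop_spec xi n None
| Loop S j of j < n & run M xi j = run M xi n
    & (forall i, j < i < n -> run M xi i <> run M xi n)
    & (forall p, p \in S <-> exists2 i, j <= i <= n & run M xi i = p) :
  loop_spec xi n (Some S).

Lemma loopP xi n : loop_spec xi n (loop (mkseq xi n)).
Proof.
rewrite /loop; set s := mkseq xi n.
have rE i : i <= n -> at_ M (take i s) = run M xi i by move=> le_in; rewrite mkseq_take.
have ss : size s = n by rewrite size_mkseq.
case: pickP => [j /andP[/eqP rj /forallP last_j]|none] /=.
  have lt_jn : j < n by rewrite -[X in _ < X]ss.
  apply: (@Loop _ _ _ j) => //.
  - by rewrite -(rE j (ltnW lt_jn)) rj ss rE.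
  - move=> i /andP[lt_ji lt_in] e; have lt_i : i < size s by rewrite ss.
    have := last_j (Ordinal lt_i); rewrite /= lt_ji ss !rE ?(ltnW lt_in) //.
    by rewrite e eqxx.
  - move=> p; rewrite inE; split=> [/existsP[i /andP[le_ji /eqP <-]]|[i /andP[le_ji le_in] <-]].
      have le_in : i <= n by rewrite -ltnS -[X in _ < X.+1]ss.
      by exists i; rewrite ?le_ji ?rE.
    have lt_i : i < (size s).+1 by rewrite ss ltnS.
    by apply/existsP; exists (Ordinal lt_i); rewrite /= le_ji rE ?eqxx.
apply: NoLoop => j lt_jn e.
pose P i := (i < n) && (run M xi i == run M xi n).
have exP : exists i, P i by exists j; rewrite /P lt_jn e eqxx.
have ubP i : P i -> i <= n by case/andP => /ltnW.
case: (ex_maxnP exP ubP) => i /andP[lt_in /eqP ei] max_i.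
have lt_i : i < size s by rewrite ss.
have := none (Ordinal lt_i); rewrite /= ss !rE ?(ltnW lt_in) // ei eqxx /=.
move/negP; apply; apply/forallP => l; apply/implyP => lt_il; apply/negP => el.
have lt_ln : l < n := ltn_ord l.
by have := max_i l; rewrite /P lt_ln -(rE l) ?(ltnW lt_ln) // el leqNgt lt_il => /(_ erefl).
Qed.

Lemma loop_cyc xi n S : loop (mkseq xi n) = Some S -> cyc S /\ run M xi n \in S.
Proof.
case: loopP => // {}S j lt_jn ej _ SP [<-].
have Sn : run M xi n \in S by apply/SP; exists n; rewrite // leqnn ltnW.
split=> //; split; first by exists (run M xi n).
  by move=> q /SP[i _ <-]; exists (mkseq xi i).
move=> p q /SP[i /andP[le_ji le_in] <-] /SP[l /andP[le_jl le_ln] <-].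
have seg a b : j <= a -> a <= b -> b <= n ->
    within S (run M xi a) (mkseq (shift a xi) (b - a)) /\
    ftrans (run M xi a) (mkseq (shift a xi) (b - a)) = run M xi b.
  move=> le_ja le_ab le_bn; split; last by rewrite -runD subnKC.
  apply/withinP => r /vis_run[c]; rewrite subnKC // => /andP[le_ac le_cb] ->.
  by apply/SP; exists c => //; rewrite (leq_trans le_ja) ?(leq_trans le_cb).
have [w1 e1] := seg i n le_ji le_in (leqnn n).
have [w2 e2] := seg j n (leqnn j) (ltnW lt_jn) (leqnn n).
have [w3 e3] := seg j l (leqnn j) le_jl le_ln.
(* Go on to position [n], whose state is also that at [j], make one full round so that the word is
   nonempty, then advance to [l]. *)
exists (mkseq (shift i xi) (n - i) ++ mkseq (shift j xi) (n - j) ++ mkseq (shift j xi) (l - j)).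
split.
- move/(congr1 size)/eqP; rewrite !size_cat !size_mkseq !addn_eq0 !subn_eq0.
  by rewrite [n <= j]leqNgt lt_jn andbF.
- by rewrite !within_cat w1 e1 -ej w2 e2 -ej.
- by rewrite !ftrans_cat e1 -ej e2 -ej.
Qed.

Lemma loop_inf xi : exists n0,
  (forall n S, n0 <= n -> loop (mkseq xi n) = Some S -> S \subset infset M xi) /\
  (forall n, exists2 m, n <= m & loop (mkseq xi m) = Some (infset M xi)).
Proof.
have [n1 in_inf] := infset_eventually M xi.
have /choice[N NP] : forall q, exists n,
    q \in infset M xi -> n1 <= n /\ run M xi n = q.
  move=> q; have [iq|_] := boolP (q \in infset M xi); last by exists 0.
  by have [m ?] := (infsetP xi q).1 iq n1; exists m.
(* Past [n0] each limit state has already been visited at or after [n1], so the loop lies where the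
   run stays in the limit set. *)
pose n0 := maxn n1 (\max_q N q).+1.
have prev n : n0 <= n -> N (run M xi n) < n /\ n1 <= N (run M xi n) /\
    run M xi (N (run M xi n)) = run M xi n.
  rewrite geq_max => /andP[le1 lt2]; split; last exact/NP/in_inf.
  by apply: leq_trans lt2; rewrite ltnS leq_bigmax.
have sub n S : n0 <= n -> loop (mkseq xi n) = Some S -> S \subset infset M xi.
  move=> /prev[lt_N [le_N eN]]; case: loopP => // {}S j lt_jn ej last_j SP [<-].
  apply/subsetP => p /SP[i /andP[le_ji _] <-]; apply: in_inf.
  apply: leq_trans le_ji; rewrite leqNgt; apply/negP => lt_j1.
  by apply: (last_j (N (run M xi n))) => //; rewrite lt_N (leq_trans lt_j1).
exists n0; split=> // n'; set n := maxn n' n0.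
have le_0n : n0 <= n by rewrite leq_maxr.
pose P m := (n <= m) &&
  [forall q in infset M xi, [exists i : 'I_m.+1, (n <= i) && (run M xi i == q)]].
have PP m : reflect (n <= m /\
    {in infset M xi, forall q, exists2 i, n <= i <= m & run M xi i = q}) (P m).
  apply: (iffP andP) => -[-> H]; split=> //.
    move=> q iq; have /forall_inP/(_ q iq)/existsP[i /andP[le_i /eqP<-]] := H.
    by exists i => //; rewrite le_i -ltnS ltn_ord.
  apply/forall_inP => q /H[i /andP[le_ni le_im] <-]; apply/existsP.
  by exists (inord i); rewrite inordK ?ltnS // le_ni eqxx.
have exP : exists m, P m.
  have /choice[h hP] : forall q, exists i, q \in infset M xi -> n <= i /\ run M xi i = q.
    move=> q; have [iq|_] := boolP (q \in infset M xi); last by exists 0.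
    by have [m ?] := (infsetP xi q).1 iq n; exists m.
  exists (maxn n (\max_q h q)); apply/PP; split; first exact: leq_maxl.
  move=> q /hP[le_n e]; exists (h q) => //; rewrite le_n /= leq_max.
  by rewrite leq_bigmax orbT.
(* At [m] the whole limit set has been seen since [n] for the first time. Hence the previous visit
   to the state at [m] does not come after [n], and the loop covers the limit set. *)
case: (ex_minnP exP) => m /PP[le_nm cover] min_m.
exists m; first exact: leq_trans (leq_maxl _ _) le_nm.
have [lt_N [le_N eN]] := prev m (leq_trans le_0n le_nm).
have sub_m := sub m _ (leq_trans le_0n le_nm).
case: loopP sub_m => [/(_ _ lt_N)/(_ eN)//|S j lt_jm ej last_j SP] /(_ S erefl) sub_m.
congr Some; apply/eqP; rewrite eqEsubset sub_m /=; apply/subsetP => q /cover.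
case=> i /andP[le_ni le_im] <-; apply/SP; exists i; rewrite ?le_im ?andbT //.
apply: leq_trans le_ni; rewrite leqNgt; apply/negP => lt_nj.
suff /min_m : P m.-1 by rewrite leqNgt; case: (m) lt_jm => // m'; rewrite /= ltnSn.
have m_gt0 : 0 < m by apply: leq_ltn_trans lt_jm.
have ltE i' : (i' <= m.-1) = (i' < m) by rewrite -ltnS prednK.
apply/PP; split; first by rewrite ltE (ltn_trans lt_nj).
move=> q' /cover[i' /andP[le_ni' le_im'] <-]; have [e|ne] := eqVneq i' m.
  by exists j; rewrite ?ltE ?lt_jm ?(ltnW lt_nj) // e.
by exists i' => //; rewrite ltE le_ni' ltn_neqAle ne.
Qed.

End Loops.

(** * The reduction built from an embedding into the target *)

Section Simulation.
Variables (X : Type) (k : nat) (A B : automaton X).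
Variables (colA : {set state A} -> 'I_k) (colB : {set state B} -> 'I_k).
Variables (F : FTk k) (Mo : 'I_(fsize F) -> {set state A}) (m : node F -> {set state A}).
Variables (MoB : 'I_(fsize F) -> {set state B}) (mB : node F -> {set state B}).
Hypotheses (embA : embeds colA Mo m) (cplA : complete Mo m) (embB : embeds colB MoB mB).
Implicit Types (u v a : node F).

(** If [S] leaves the outer cycle, move forward in the outer forest; otherwise extend the deepest
    ancestor of [u] whose cycle contains [S], or stay in the same inner tree if there is none. The
    last clause keeps the node above every such ancestor. *)
Lemma update_node : exists next : node F -> {set state A} -> node F, forall u S,
  cyc S -> reachS (m u) S ->
  [/\ m (next u S) = S, fle (tag u) (tag (next u S))
    & S \subset Mo (tag u) -> forall a, nle a u -> S \subset m a -> nle a (next u S)].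
Proof.
have [_ cov_reach cov_in ext _] := cplA; have [cM cm mm _ _] := embA.
suff H u : exists f : {set state A} -> node F, forall S, cyc S -> reachS (m u) S ->
    [/\ m (f S) = S, fle (tag u) (tag (f S))
      & S \subset Mo (tag u) -> forall a, nle a u -> S \subset m a -> nle a (f S)].
  by have [next nextP] := choice H; exists next.
suff {}H S : exists v, cyc S -> reachS (m u) S -> [/\ m v = S, fle (tag u) (tag v)
      & S \subset Mo (tag u) -> forall a, nle a u -> S \subset m a -> nle a v].
  by have [f fP] := choice H; exists f.
have [cS|nc] := pselect (cyc S); last by exists u.
have [sub|nsub] := boolP (S \subset Mo (tag u)); last first.
  have [r|nr] := pselect (reachS (m u) S); last by exists u.
  have [|v uv ev] := cov_reach (tag u) S cS; last by exists v.
  have [_ /subsetP sub] := cm u; have [p [q [mp Sq pq]]] := r.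
  by exists p, q; split=> //; apply: sub.
pose anc := [set a | nle a u & S \subset m a].
have [e|ne] := eqVneq anc set0.
  have [v tv ev] := cov_in _ _ cS sub; exists v => _ _; split=> //.
    by rewrite tv fle_refl.
  by move=> _ a au sa; have : a \in anc; [rewrite inE au|rewrite e inE].
have [|a + max_a] := chain_max (@nle_trans _ F) (@nle_refl _ F) _ ne.
  move=> a b; rewrite !inE => /andP[au _] /andP[bu _]; exact: nle_cone_chain au bu.
rewrite inE => /andP[au sa]; have [v av ev] := ext _ _ cS sa; exists v => _ _; split=> //.
  by rewrite -(nle_tag au) (nle_tag av) fle_refl.
by move=> _ b bu sb; apply: nle_trans av; apply: max_a; rewrite inE bu.
Qed.

(** The block tours the cycle of the deepest common ancestor of [u] and [v], hence stays in the
    cycle of every common ancestor. Without one, it travels along the outer forest and then tours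
    [mB v]. [None] stands for the start, before any node is chosen. *)
Lemma follow_node : exists blk : option (node F) -> state B -> node F -> seq X,
  forall o p v, (if o is Some u then p \in mB u /\ fle (tag u) (tag v) else p = init B) ->
  [/\ blk o p v <> [::], {subset mB v <= vis p (blk o p v)}, ftrans p (blk o p v) \in mB v
    & forall u a, o = Some u -> nle a u -> nle a v -> within (mB a) p (blk o p v)].
Proof.
have [cN cn nn _ rN] := embB.
suff H (t : option (node F) * state B * node F) : exists b,
    (if t.1.1 is Some u then t.1.2 \in mB u /\ fle (tag u) (tag t.2) else t.1.2 = init B) ->
    [/\ b <> [::], {subset mB t.2 <= vis t.1.2 b}, ftrans t.1.2 b \in mB t.2
    & forall u a, t.1.1 = Some u -> nle a u -> nle a t.2 -> within (mB a) t.1.2 b].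
  by have [f fP] := choice H; exists (fun o p v => f (o, p, v)) => o p v; exact: (fP (o, p, v)).
case: t => [[o p] v] /=; have [cv subv] := cn v; have [[r nr] init_v _] := cv.
have walk q : reach p q -> q \in mB v ->
    exists b, [/\ b <> [::], {subset mB v <= vis p b} & ftrans p b \in mB v].
  case=> b <- nq; have [c [c0 wc sc ec]] := tour cv nq nr.
  exists (b ++ c); split; first by case: (b) c0.
    by move=> x /sc; rewrite vis_cat => ->; rewrite orbT.
  by rewrite ftrans_cat ec.
case: o => [u|]; last first.
  have [ep|np] := pselect (p = init B); last by exists [::].
  have [|b [w0 w1 w2]] := walk r _ nr; first by rewrite ep; apply: init_v.
  by exists b.
have [[pu uv]|nh] := pselect (p \in mB u /\ fle (tag u) (tag v)); last by exists [::].
pose anc := [set a | nle a u & nle a v].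
have [e|ne] := eqVneq anc set0.
  have [p' [q' [np nq pq]]] := rN _ _ uv.
  have [|b [w0 w1 w2]] := walk r _ nr.
    have [_ /subsetP sub_u] := cn u.
    apply: reach_trans (cyc_reach (cN _) (sub_u _ pu) np) _; apply: reach_trans pq _.
    exact: cyc_reach (cN _) nq (subsetP subv _ nr).
  exists b => _; split=> // _ a [<-] au av.
  by have : a \in anc; [rewrite inE au|rewrite e inE].
have [|a + max_a] := chain_max (@nle_trans _ F) (@nle_refl _ F) _ ne.
  move=> a b; rewrite !inE => /andP[au _] /andP[bu _]; exact: nle_cone_chain au bu.
rewrite inE => /andP[au av]; have [ca _] := cn a.
have [b [b0 wb sb eb]] := tour ca (subsetP (nn _ _ au) _ pu) (subsetP (nn _ _ av) _ nr).
exists b => _; split=> //.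
- by move=> q nq; apply: sb; apply: (subsetP (nn _ _ av)).
- by rewrite eb.
- move=> _ a' [<-] a'u a'v; apply: within_sub wb; apply: nn; apply: max_a.
  by rewrite inE a'u.
Qed.

Variables (LA LB : kpartition X k).
Hypotheses (hA : colored LA colA) (hB : colored LB colB).

Lemma simulation : leCA LA LB.
Proof.
have [cover _ _ _ inj] := cplA; have [cM cm mm colm _] := embA.
have [cN cn nn coln _] := embB.
have [next nextP] := update_node; have [blk blkP] := follow_node.
have [v0 _ _] := nle_root (Ordinal (fsize_gt0 F)).
have /choice[start startP] : forall S, exists v, cyc S -> m v = S.
  move=> S; have [cS|nc] := pselect (cyc S); last by exists v0.
  by have [v ev] := cover _ cS; exists v.
pose new (o : option (node F)) S := if o is Some u then next u S else start S.
pose upd xi n (p : option (node F) * seq X) :=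
  if loop A (mkseq xi n) is Some Z then
    (Some (new p.1 Z), p.2 ++ blk p.1 (at_ B p.2) (new p.1 Z)) else p.
pose st xi n := iteri n (upd xi) (None, [::]).
have st_prefix xi eta n : mkseq xi n = mkseq eta n -> st xi n = st eta n.
  elim: n => [//|n IHn] e; have en : mkseq xi n = mkseq eta n.
    by rewrite -(mkseq_take xi (leqnSn n)) e mkseq_take.
  by rewrite /st /= -/(st xi n) -/(st eta n) IHn // /upd en.
pose out xi n := (st xi n).2.
pose block xi n := if loop A (mkseq xi n) is Some Z
  then blk (st xi n).1 (at_ B (out xi n)) (new (st xi n).1 Z) else [::].
have outS xi n : out xi n.+1 = out xi n ++ block xi n.
  rewrite /out /st /= -/(st xi n) /upd /block.
  by case: (loop A (mkseq xi n)) => [S|] //=; rewrite cats0.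
have nodeS xi n : (st xi n.+1).1 =
    if loop A (mkseq xi n) is Some Z then Some (new (st xi n).1 Z) else (st xi n).1.
  by rewrite /st /= -/(st xi n) /upd; case: (loop A (mkseq xi n)).
(* The past visit to [m u] makes every later loop reachable from it, as [next] requires; the
   position of the output in [mB u] is what [blk] requires. *)
pose inv xi n := if (st xi n).1 is Some u then
    at_ B (out xi n) \in mB u /\ exists2 j, j < n & run A xi j \in m u else out xi n = [::].
have ready xi n S : inv xi n -> loop A (mkseq xi n) = Some S ->
    m (new (st xi n).1 S) = S /\
    (if (st xi n).1 is Some u then at_ B (out xi n) \in mB u /\
      fle (tag u) (tag (new (st xi n).1 S)) else at_ B (out xi n) = init B).
  rewrite /inv => + /loop_cyc[cS Sn]; case: (st xi n).1 => [u [nu [j lt_jn mj]]|->] /=.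
    have [|-> le_uv _] := nextP u S cS; last by [].
    by exists (run A xi j), (run A xi n); split=> //; apply: reach_run; apply: ltnW.
  by rewrite startP.
have invP xi n : inv xi n.
  elim: n => [//|n IHn]; rewrite /inv nodeS outS /block.
  case e : (loop A (mkseq xi n)) => [S|].
    have [eS rdy] := ready _ _ _ IHn e; have [_ Sn] := loop_cyc e.
    have [_ _ last_in _] := blkP _ _ _ rdy.
    by rewrite at_cat; split=> //; exists n; rewrite // eS.
  rewrite cats0; move: IHn; rewrite /inv; case: (st xi n).1 => [u [? [j lt_jn ?]]|] //.
  by split=> //; exists j => //; apply: ltnW.
have {}ready xi n S := ready xi n S (invP xi n).
have blockP xi n S : loop A (mkseq xi n) = Some S ->
  [/\ block xi n <> [::], {subset mB (new (st xi n).1 S) <= vis (at_ B (out xi n)) (block xi n)},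
    ftrans (at_ B (out xi n)) (block xi n) \in mB (new (st xi n).1 S)
    & forall u a, (st xi n).1 = Some u -> nle a u -> nle a (new (st xi n).1 S) ->
        within (mB a) (at_ B (out xi n)) (block xi n)].
  by move=> e; rewrite /block e; apply: blkP; have [] := ready xi n S e.
have out_big xi n : exists m, n <= size (out xi m).
  elim: n => [|n [i le_i]]; first by exists 0.
  have [n0 [_ /(_ i)[j le_ij ej]]] := loop_inf A xi; exists j.+1.
  rewrite outS size_cat -addn1; apply: leq_add.
    by apply: leq_trans le_i _; apply: (chain_size (outS xi)).
  by have [+ _ _ _] := blockP _ _ _ ej; case: (block xi j).
have /choice[g gP] : forall xi, exists eta, forall n, pre (out xi n) eta.
  by move=> xi; apply: chain_limit (outS xi) (out_big xi).
exists g; split=> [xi n|xi].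
  have [i le_i] := out_big xi n; exists i => eta /agreeP e; apply/agreeP.
  have eo : out eta i = out xi i by rewrite /out (st_prefix _ _ _ e).
  have := gP eta i; rewrite eo /pre => e1; have := gP xi i; rewrite /pre => e2.
  by rewrite -(mkseq_take (g xi) le_i) e2 -e1 mkseq_take.
(* From [n1] on every loop is contained in the limit set [S0], and the loop at [n1] equals it. Hence
   the node stays above [a0], and is [a0] again whenever a later loop is [S0]. *)
have [n0 [sub inf]] := loop_inf A xi; set S0 := infset A xi in sub inf.
have [n1 le_n01 e1] := inf n0; pose a0 := new (st xi n1).1 S0.
have ma0 : m a0 = S0 by have [] := ready _ _ _ e1.
have sub_a0 : S0 \subset Mo (tag a0) by rewrite -ma0; have [] := cm a0.
have above n : n1 < n -> exists2 u, (st xi n).1 = Some u & nle a0 u.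
  elim: n => [//|n IHn]; rewrite ltnS leq_eqVlt => /predU1P[<-|lt_n].
    by exists a0; rewrite ?nodeS ?e1 ?nle_refl.
  have [u eu a0u] := IHn lt_n; rewrite nodeS.
  case e : (loop A (mkseq xi n)) => [S|]; last by exists u.
  exists (new (st xi n).1 S) => //; rewrite eu /=.
  have [cS Sn] := loop_cyc e.
  have sS : S \subset S0 by apply: sub e; apply: leq_trans le_n01 (ltnW lt_n).
  have [|_ _ H] := nextP u S cS.
    have := invP xi n; rewrite /inv eu => -[_ [j lt_jn mj]].
    by exists (run A xi j), (run A xi n); split=> //; apply: reach_run; apply: ltnW.
  apply: H => //; last by rewrite ma0.
  by rewrite -(nle_tag a0u); apply: subset_trans sub_a0.
have lim : inf_states (g xi) (mB a0).
  (* The block emitted at [n1] still leads from the old node to [a0], so only blocks from [n1.+1] on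
     are counted. *)
  apply: (inf_blocks (outS xi) (out_big xi) (gP xi) (n0 := n1.+1)) => [n lt_n|q n qa].
    have [u eu a0u] := above _ lt_n.
    case e : (loop A (mkseq xi n)) => [S|]; last first.
      rewrite /block e within_nil; have := invP xi n; rewrite /inv eu => -[+ _].
      exact/subsetP/nn.
    have [_ _ _ H] := blockP _ _ _ e; apply: H eu a0u _.
    by have [v' + ?] := above n.+1 (leqW lt_n); rewrite nodeS e => -[->].
  have [i le_i ei] := inf (maxn n n1.+1); move: le_i; rewrite geq_max => /andP[le_ni lt_i].
  exists i => //; have [_ H _ _] := blockP _ _ _ ei; apply: H.
  have [v' + a0v] := above i.+1 (leqW lt_i); rewrite nodeS ei => -[ev].
  rewrite ev; have <- // : a0 = v'.
  by apply: inj => //; rewrite ma0 -ev; have [-> _] := ready _ _ _ ei.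
rewrite (hB lim) coln -colm ma0; apply: hA; exact: infsetP.
Qed.

End Simulation.

(** * Aperiodic realization of forests *)

Section Realization.
Variables (X : finType) (c0 c1 : X) (k : nat) (F : FTk k) (d : node F).
Hypothesis c10 : c1 != c0.
Notation N := (node F).
Notation K := #|{: N}|.
Notation Z := (option N).
Implicit Types (u v y : N) (z : Z) (i j : 'I_K.+1) (w : seq X) (U : {set N}).

(* After [c0^i] with [i < K], a letter other than [c0] is a request to move to the [i]-th
   node; it is granted when the outer component does not move backwards.  At [K] the counter
   saturates, and there a letter other than [c0] just resets it: the counter can thus be
   emptied without leaving the current node.  The initial value [None] cannot survive the
   saturation, so that it lies on no cycle. *)
Definition decode i : Z := nth None (map Some (enum {: N})) i.
Definition accept z y : N := if z is Some u then (if fle (tag u) (tag y) then y else u) else y.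
Definition request z i : N := if decode i is Some y then accept z y else odflt d z.
Definition tick i : 'I_K.+1 := inord (minn i.+1 K).
Definition step (q : Z * 'I_K.+1) (x : X) : Z * 'I_K.+1 :=
  if x == c0 then (if K <= q.2.+1 then Some (odflt d q.1) else q.1, tick q.2)
  else (Some (request q.1 q.2), ord0).
Definition machine := @Automaton X (Z * 'I_K.+1)%type step (None, ord0).

(** A preorder that steps can only increase; equivalent nodes are those of the same inner tree. *)
Definition lez z z' :=
  match z, z' with Some u, Some v => fle (tag u) (tag v) | None, _ => true | _, _ => false end.

Lemma lez_refl z : lez z z.
Proof. by case: z => //= u; apply: fle_refl. Qed.

Lemma lez_trans z z' z'' : lez z z' -> lez z' z'' -> lez z z''.
Proof. by case: z z' z'' => [u|] [v|] [w|] //=; apply: fle_trans. Qed.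

Lemma lez_eqv u v : lez (Some u) (Some v) -> lez (Some v) (Some u) -> tag u = tag v.
Proof. exact: fle_anti. Qed.

Lemma lez_fill z : lez z (Some (odflt d z)).
Proof. by case: z => //= u; apply: fle_refl. Qed.

Lemma lez_step q x : lez q.1 (step q x).1.
Proof.
case: q => z i; rewrite /step; case: ifP => _ /=.
  by case: ifP => _; [apply: lez_fill|apply: lez_refl].
rewrite /request; case: (decode i) => [y|]; last exact: lez_fill.
by case: z => //= u; case: ifP => //; rewrite fle_refl.
Qed.

Lemma lez_ftrans (q : state machine) w : lez q.1 (ftrans q w).1.
Proof.
elim: w q => [|x w IHw] q; first exact: lez_refl.
exact: lez_trans (lez_step q x) (IHw _).
Qed.

Lemma lez_reach (q q' : state machine) : reach q q' -> lez q.1 q'.1.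
Proof. by case=> w <-; apply: lez_ftrans. Qed.

Lemma val_tick i : tick i = minn i.+1 K :> nat.
Proof. by rewrite inordK // ltnS geq_minr. Qed.

Lemma Some_ftrans u (i j : 'I_K.+1) w : ftrans (M := machine) (Some u, i) w <> (None, j).
Proof. by move=> e; have := lez_ftrans (Some u, i) w; rewrite e. Qed.

(** While the node is [None] the counter counts every letter, so such a state never returns to
    itself. *)
Lemma None_ftrans (i j : 'I_K.+1) w :
  ftrans (M := machine) (None, i) w = (None, j) -> (j = i + size w :> nat).
Proof.
elim: w i => [|x w IHw] i; first by case=> ->; rewrite addn0.
rewrite -cat1s ftrans_cat {2}/ftrans /= /step; case: ifP => _ /=; last by move/Some_ftrans.
case: ifP => [_ /Some_ftrans//|/negbT]; rewrite -ltnNge => lt_iK /IHw->.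
by rewrite val_tick (minn_idPl _) ?addSnnS // ltnW.
Qed.

Lemma cyc_Some (S : {set state machine}) z i : cyc S -> (z, i) \in S -> z <> None.
Proof.
move=> [_ _ conn] Sz ez; rewrite ez in Sz; have [w [w0 _ /None_ftrans/eqP]] := conn _ _ Sz Sz.
by rewrite -[X in X == _]addn0 eqn_add2l; case: (w) w0.
Qed.

Implicit Type S : {set state machine}.

Definition nodes (S : {set state machine}) : {set N} :=
  [set y | [exists i, (Some y, i) \in S]].

Lemma nodesP (S : {set state machine}) y : reflect (exists i, (Some y, i) \in S) (y \in nodes S).
Proof. by rewrite inE; apply: existsP. Qed.

Lemma nodes_sub (S S' : {set state machine}) : S \subset S' -> nodes S \subset nodes S'.
Proof.
by move=> /subsetP sub; apply/subsetP => y /nodesP[i /sub ?]; apply/nodesP; exists i.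
Qed.

Lemma cyc_nodes (S : {set state machine}) : cyc S -> nodes S != set0.
Proof.
move=> cS; have [[[[y|] i] Sq] _ _] := cS; last by case: (cyc_Some cS Sq).
by apply/set0Pn; exists y; apply/nodesP; exists i.
Qed.

Lemma cyc_tag (S : {set state machine}) y y' :
  cyc S -> y \in nodes S -> y' \in nodes S -> tag y = tag y'.
Proof.
move=> cS /nodesP[i Sy] /nodesP[i' Sy']; apply: lez_eqv.
  exact: (lez_reach (cyc_reach cS Sy Sy')).
exact: (lez_reach (cyc_reach cS Sy' Sy)).
Qed.

(** * Greatest lower bounds and the colouring of the machine *)

Definition is_glb (U : {set N}) r :=
  [forall y in U, nle r y] && [forall r', [forall y in U, nle r' y] ==> nle r' r].

Lemma is_glbP (U : {set N}) r : reflect ({in U, forall y, nle r y} /\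
    forall r', {in U, forall y, nle r' y} -> nle r' r) (is_glb U r).
Proof.
apply: (iffP andP) => -[/forall_inP H1 H2]; split=> //.
  by move=> r' Hr'; have /forallP/(_ r')/implyP := H2; apply; apply/forall_inP.
by apply/forallP => r'; apply/implyP => /forall_inP/H2.
Qed.

Lemma glb_exists (U : {set N}) y0 : y0 \in U -> {in U, forall y, tag y = tag y0} ->
  exists2 r, is_glb U r & tag r = tag y0.
Proof.
move=> Uy0 tagU; pose lb := [set r | [forall y in U, nle r y]].
have lbP r : reflect {in U, forall y, nle r y} (r \in lb) by rewrite inE; apply: forall_inP.
have [||r /lbP lb_r max_r] := chain_max (A := lb) (@nle_trans _ F) (@nle_refl _ F).
- move=> a b /lbP/(_ _ Uy0) ay /lbP/(_ _ Uy0) by0; exact: nle_cone_chain ay by0.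
- have [r _ rP] := nle_root (tag y0); apply/set0Pn; exists r; apply/lbP => y /tagU.
  exact: rP.
exists r; last exact/nle_tag/lb_r.
by apply/is_glbP; split=> // r' Hr'; apply: max_r; apply/lbP.
Qed.

(** On a cycle the nodes share their outer node and have a greatest lower bound; [d] only serves
    other sets. *)
Definition mcol (S : {set state machine}) : 'I_k :=
  nlab (odflt d [pick r | is_glb (nodes S) r]).

Lemma mcolE S r : is_glb (nodes S) r -> mcol S = nlab r.
Proof.
rewrite /mcol; case: pickP => [r'|/(_ r)->//] /is_glbP[lb' max'] /is_glbP[lb max] /=.
by congr nlab; apply: nle_anti; [apply: max|apply: max'].
Qed.

(** The nodes of an outer cycle share one outer node, the image of [x]. An inner cycle is sent to
    the greatest lower bound of its nodes, which moves up as the cycle shrinks. *)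
Lemma embeddable_machine G : embeddable mcol G -> leF G F.
Proof.
case=> Mo [m [cM cm mm colm rM]].
have /choice[phi phiP] : forall x, exists x', {in nodes (Mo x), forall y, tag y = x'}.
  move=> x; have /set0Pn[y0 Hy0] := cyc_nodes (cM x).
  by exists (tag y0) => y Hy; apply: cyc_tag Hy Hy0.
exists phi; split=> [x x' /rM[[z i] [[z' i'] [Mp Mq pq]]]|x].
  case: z Mp pq => [y|] Mp pq; last by case: (cyc_Some (cM x) Mp).
  case: z' Mq pq => [y'|] Mq pq; last by case: (cyc_Some (cM x') Mq).
  have <- : tag y = phi x by apply: phiP; apply/nodesP; exists i.
  have <- : tag y' = phi x' by apply: phiP; apply/nodesP; exists i'.
  exact: (lez_reach pq).
have glb (s : 'I_(fsize (proj1_sig (flab x)))) :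
    exists t, is_glb (nodes (m (mknode s))) (@mknode _ F (phi x) t).
  have [cs sub] := cm (mknode s); have /set0Pn[y0 Hy0] := cyc_nodes cs.
  have tagP : {in nodes (m (mknode s)), forall y, tag y = phi x}.
    by move=> y Hy; apply: phiP; exact: (subsetP (nodes_sub sub) _ Hy).
  have [|[x' t] Hr /=] := glb_exists Hy0; first by move=> y Hy; rewrite !tagP.
  by rewrite tagP // => e; subst x'; exists t.
have [psi psiP] := choice glb.
exists psi; split=> [s t st|s].
  rewrite -(nle_mknode (psi s)); have /is_glbP[_] := psiP t; apply=> y Hy.
  have /is_glbP[+ _] := psiP s; apply; apply: (subsetP (nodes_sub _) _ Hy).
  by apply: mm; rewrite nle_mknode.
by have := colm (mknode s); rewrite (mcolE (psiP s)).
Qed.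

(** * The embedding of the forest into its machine *)

Definition block (U : {set N}) : {set state machine} :=
  [set q | if q.1 is Some y then y \in U else false].

Lemma nodes_block (U : {set N}) : nodes (block U) = U.
Proof.
apply/setP => y; apply/nodesP/idP => [[i]|Uy]; first by rewrite inE.
by exists ord0; rewrite inE.
Qed.

Lemma decode_index y : exists2 i : 'I_K.+1, i < K & decode i = Some y.
Proof.
have lt_i : index y (enum {: N}) < K by rewrite cardE index_mem mem_enum.
exists (Ordinal (ltnW lt_i : _ < K.+1)) => //.
by rewrite /decode (nth_map y) ?nth_index ?mem_enum // -cardE.
Qed.

Lemma decode_last : decode ord_max = None.
Proof. by rewrite /decode nth_default // size_map -cardE. Qed.

Definition linked (S : {set state machine}) (p q : state machine) :=
  exists2 w, within S p w & ftrans p w = q.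

Lemma linked_trans S q p r : linked S p q -> linked S q r -> linked S p r.
Proof.
by case=> w ww <- [w' ww' <-]; exists (w ++ w'); rewrite ?within_cat ?ww ?ftrans_cat.
Qed.

Lemma linked_step S p x : p \in S -> step p x \in S -> linked S p (step p x).
Proof. by move=> Sp Sq; exists [:: x]; rewrite // /within /= Sp Sq. Qed.

Lemma linked_tick (U : {set N}) y i j : y \in U -> i <= j ->
  linked (block U) (Some y, i) (Some y, j).
Proof.
move=> Uy le_ij; have bU i' : (Some y, i') \in block U by rewrite inE.
case: j le_ij => j' lt_j /=; elim: j' lt_j => [|j' IHj] lt_j le_ij.
  have <- : i = Ordinal lt_j by apply/val_inj => /=; move: le_ij; case: (nat_of_ord i).
  by exists [::]; rewrite ?within_nil.
move: le_ij; rewrite leq_eqVlt => /predU1P[e|].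
  have <- : i = Ordinal lt_j by apply/val_inj.
  by exists [::]; rewrite ?within_nil.
rewrite ltnS => /(IHj (ltnW lt_j)) H; apply: linked_trans H _.
have -> : (Some y, Ordinal lt_j) = step (Some y, Ordinal (ltnW lt_j)) c0.
  rewrite /step eqxx /=; case: ifP => _; congr (_, _); apply/val_inj => /=;
  by rewrite val_tick (minn_idPl _).
apply: linked_step; rewrite // /step eqxx; case: ifP => _; exact: bU.
Qed.

Lemma step_other z i : step (z, i) c1 = (Some (request z i), ord0).
Proof. by rewrite /step (negPf c10). Qed.

Lemma linked_jump (U : {set N}) y y' j : y \in U -> y' \in U -> tag y = tag y' ->
  linked (block U) (Some y, ord0) (Some y', j).
Proof.
move=> Uy Uy' e; have [c _ dc] := decode_index y'.
apply: linked_trans (linked_tick Uy (leq0n c : ord0 <= c)) _.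
have eq_step : step (Some y, c) c1 = (Some y', ord0).
  by rewrite step_other /request dc /= e fle_refl.
apply: linked_trans (linked_tick (i := ord0) (j := j) Uy' (leq0n j)).
by rewrite -eq_step; apply: linked_step; rewrite ?eq_step inE.
Qed.

Lemma init_ticks (c : 'I_K.+1) : c < K -> reach (init machine) (None, c).
Proof.
case: c => c /= lt_c; elim: c lt_c => [|c IHc] lt_c lt_cK.
  by exists [::]; congr (_, _); apply/val_inj.
apply: reach_trans (IHc (ltnW lt_c) (ltnW lt_cK)) _; exists [:: c0].
rewrite /ftrans /= /step eqxx /= leqNgt lt_cK; congr (_, _); apply/val_inj => /=.
by rewrite val_tick (minn_idPl _) // ltnW.
Qed.

(** To change state, count up to saturation, reset the counter there without any request, then count
    up to the code of the target node and request it. *)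
Lemma cyc_block (U : {set N}) y0 : y0 \in U -> {in U, forall y, tag y = tag y0} -> cyc (block U).
Proof.
move=> Uy0 tagU; split.
- by exists (Some y0, ord0); rewrite inE.
- move=> [[y|] j]; rewrite inE //= => Uy; have [c lt_c dc] := decode_index y.
  apply: reach_trans (init_ticks lt_c) _; apply: (@reach_trans _ machine (Some y, ord0)).
    by exists [:: c1]; rewrite /ftrans /= step_other /request dc.
  by have [w _ <-] := linked_tick (i := ord0) (j := j) Uy (leq0n j); exists w.
move=> [[y|] i] [[y'|] j]; rewrite ?inE //= => Uy Uy'.
have [w ww ew] := linked_tick (i := i) (j := ord_max) Uy (leq_ord i).
have [|w' ww' ew'] := @linked_jump U y y' j Uy Uy'; first by rewrite !tagU.
have es : step (Some y, ord_max) c1 = (Some y, ord0).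
  by rewrite step_other /request decode_last.
exists (w ++ c1 :: w'); split; first by case: (w).
  rewrite within_cat ww ew andTb; apply/andP; split; first by rewrite inE.
  by move: ww'; rewrite -es.
by rewrite ftrans_cat ew -ew' -es.
Qed.

(** An outer node is sent to the block of its whole inner tree, an inner node to the block of its
    upper cone, whose greatest lower bound is that node. *)
Lemma machine_embeddable : embeddable mcol F.
Proof.
pose out x := [set y : N | tag y == x]; pose up u := [set y | nle u y].
have cout x : cyc (block (out x)).
  have [r tr _] := nle_root x; apply: (@cyc_block _ r); rewrite ?inE ?tr // => y.
  by rewrite inE => /eqP.
exists (fun x => block (out x)), (fun u => block (up u)); split.
- exact: cout.
- move=> u; split; last first.
    apply/subsetP => -[[y|] i]; rewrite !inE //= !inE => uy.
    by rewrite -(nle_tag uy).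
  apply: (@cyc_block _ u); rewrite ?inE ?nle_refl // => y; rewrite inE.
  by move/nle_tag.
- move=> u v uv; apply/subsetP => -[[y|] i]; rewrite !inE //= !inE; exact: nle_trans.
- move=> u; apply: mcolE; rewrite nodes_block; apply/is_glbP; split=> [y|r].
    by rewrite inE.
  by apply; rewrite inE nle_refl.
move=> x y xy; have [r tr _] := nle_root x; have [r' tr' _] := nle_root y.
have [c _ dc] := decode_index r'.
exists (Some r, c), (Some r', ord0); rewrite !inE /= !inE tr tr' !eqxx; split=> //.
by exists [:: c1]; rewrite /ftrans /= step_other /request dc /= tr tr' xy.
Qed.


(** * Aperiodicity of the machine *)

Definition counter i w : 'I_K.+1 := foldl (fun i x => if x == c0 then tick i else ord0) i w.
Definition act i w z : Z := (ftrans (M := machine) (z, i) w).1.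

Lemma ftrans_cons (q : state machine) x w :
  ftrans q (x :: w) = ftrans (step q x : state machine) w.
Proof. by []. Qed.

Lemma ftransE z i w : ftrans (M := machine) (z, i) w = (act i w z, counter i w).
Proof.
rewrite /act; elim: w z i => [//|x w IHw] z i; rewrite ftrans_cons.
by rewrite /counter /= /step /=; case: ifP => _; rewrite IHw.
Qed.

Lemma act_cons i x w z :
  act i (x :: w) z = act (step (z, i) x).2 w (step (z, i) x).1.
Proof. by rewrite {1}/act ftrans_cons; case: (step (z, i) x). Qed.

Lemma counter_cat i w w' : counter i (w ++ w') = counter (counter i w) w'.
Proof. exact: foldl_cat. Qed.

(** A letter other than [c0] resets the counter and erases its past; words without such a letter
    never decrease it. *)
Lemma counter_mono_or_const w :
  (forall i, i <= counter i w) \/ (forall i j, counter i w = counter j w).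
Proof.
elim: w => [|x w IHw]; first by left.
case e : (x == c0); last by right => i j; rewrite /counter /= e.
have countE i : counter i (x :: w) = counter (tick i) w by rewrite /counter /= e.
case: IHw => H; [left|right] => [i|i j]; last by rewrite !countE; apply: H.
rewrite countE; apply: leq_trans (H _); rewrite val_tick leq_min leqnSn /=.
exact: leq_ord.
Qed.

Lemma counter_period i w n : 0 < n -> counter i (flatten (nseq n w)) = i -> counter i w = i.
Proof.
case: n => // n _; have [mono|const] := counter_mono_or_const w.
  rewrite /= counter_cat => e; apply/val_inj/eqP; rewrite eqn_leq mono andbT.
  rewrite -[X in _ <= val X]e; elim: n (counter i w) {e} => [|n IHn] j; first exact: leqnn.
  by rewrite /= counter_cat; apply: leq_trans (IHn _).
have -> : nseq n.+1 w = nseq n w ++ nseq 1 w by rewrite -nseqD addn1.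
rewrite flatten_cat /= cats0 counter_cat => e.
by rewrite -[RHS]e; apply: const.
Qed.

(** Within one inner tree a granted request forgets the current node, and any other step keeps
    it. *)
Lemma step_eqv z z' i x : lez z z' -> lez z' z -> lez (step (z, i) x).1 z ->
  (step (z, i) x).1 = (step (z', i) x).1 \/
  (step (z, i) x).1 = z /\ (step (z', i) x).1 = z'.
Proof.
have fill a b : lez a b -> lez b a -> lez (Some (odflt d a)) a ->
    Some (odflt d a) = a /\ Some (odflt d b) = b.
  by case: a b => [u|] [v|].
move=> zz' z'z; rewrite /step; case: ifP => _ /=.
  by case: ifP => _ le_z; right; [apply: fill|].
rewrite /request; case: (decode i) => [y|] le_z; last by right; apply: fill.
case: z z' zz' z'z le_z => [u|] [v|] // uv vu _ /=.
rewrite (lez_eqv uv vu); case: ifP => _; first by left.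
by right.
Qed.

Lemma act_eqv i w z z' : lez z z' -> lez z' z -> lez (act i w z) z ->
  act i w z = act i w z' \/ act i w z = z /\ act i w z' = z'.
Proof.
elim: w z z' i => [|x w IHw] z z' i zz' z'z; first by right.
rewrite !act_cons; set q := step (z, i) x; set q' := step (z', i) x => le_z.
have e2 : q'.2 = q.2 by rewrite /q /q' /step; case: ifP.
have le_q : lez q.1 (act q.2 w q.1) by exact: (lez_ftrans (q.1, q.2) w).
have [e|[e e']] := step_eqv (i := i) (x := x) zz' z'z (lez_trans le_q le_z).
  by left; rewrite e2; rewrite /q e.
by move: le_z; rewrite e2 /q /q' e e' -/q; apply: IHw.
Qed.

(* A word fixing the counter acts on the first component either as the identity or as a
   constant, as long as the outer node does not change; so its orbits have period 1. *)
Lemma machine_aperiodic : aperiodic_automaton machine.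
Proof.
move=> [z i] w n _ n_gt0; rewrite !ftransE => -[ez ei].
have ci := counter_period n_gt0 ei; rewrite ci; congr (_, _).
have iterE m z' : act i (flatten (nseq m w)) z' = iter m (act i w) z'.
  elim: m z' => [//|m IHm] z'; rewrite iterSr -IHm /= /act ftrans_cat.
  by rewrite ftransE ci.
have le_act z' m : lez z' (iter m (act i w) z').
  by rewrite -iterE; apply: (lez_ftrans (z', i)).
move: ez; rewrite iterE; case: n n_gt0 {ei} => // n _ ez.
have le_z : lez (act i w z) z by rewrite -[X in lez _ X]ez iterSr le_act.
(* Compare [z] with its image: either the image is a fixed point, reached again after [n] more
   rounds at [z], or [z] is itself fixed. *)
have [|e|[]//] := @act_eqv i w z (act i w z) _ le_z le_z.
  exact: (le_act z 1).
have fixed m : iter m (act i w) (act i w z) = act i w z by elim: m => //= m ->.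
by rewrite -[RHS]ez iterSr fixed.
Qed.

Definition machine_partition : kpartition X k := fun xi => mcol (infset machine xi).

Lemma machine_colored : colored machine_partition mcol.
Proof. by move=> xi S /inf_states_infset->. Qed.

Lemma machine_partition_aperiodic (c : 'I_k) : aperiodic (fun xi => machine_partition xi = c).
Proof.
exists machine, [set S | mcol S == c]; split; first exact: machine_aperiodic.
move=> xi; split=> [e|[S]]; last by rewrite inE => /eqP<- /machine_colored.
by exists (infset machine xi); [rewrite inE; apply/eqP|apply: infsetP].
Qed.

End Realization.

(** * The isomorphisms *)

Lemma leh_trans (Q : Type) (R : Q -> Q -> Prop) (F G H : forest Q) :
  (forall a b c, R a b -> R b c -> R a c) -> leh R F G -> leh R G H -> leh R F H.
Proof.
move=> R_trans [f [fm fl]] [g [gm gl]]; exists (g \o f).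
by split=> [x y /fm/gm//|x]; apply: R_trans (fl x) (gl _).
Qed.

Lemma leF_trans k (F G H : FTk k) : leF F G -> leF G H -> leF F H.
Proof. by apply: leh_trans => S T U; apply: leh_trans => a b c ->. Qed.

Lemma leCA_refl (X : Type) k (L : kpartition X k) : leCA L L.
Proof. by exists id; split=> // xi n; exists n. Qed.

Lemma inf_states_image (X : Type) (M M' : automaton X) (h : state M -> state M') xi S :
  (forall n, h (run M xi n) = run M' xi n) -> inf_states xi S -> inf_states xi (h @: S).
Proof.
move=> hrun /inf_states_infset-> p; split=> [/imsetP[q /infsetP inf_q ->] n|inf_p].
  by have [m [le_nm <-]] := inf_q n; exists m.
have [n in_inf] := infset_eventually M xi; have [m [le_nm <-]] := inf_p n.
by rewrite -hrun imset_f ?in_inf.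
Qed.

(** * Partitions and the forests that represent them *)

Section Presentation.
Variables (X : finType) (x0 : X) (k : nat).
Implicit Types (L : kpartition X k) (F : FTk k).

(** In the product of the automata of all components, the limit set projects onto each of theirs, so
    it determines the colour. Sets that are no limit sets get an arbitrary colour. *)
Lemma regular_colored L : (forall i, regular (fun xi => L xi = i)) ->
  exists (M : automaton X) (col : {set state M} -> 'I_k), colored L col.
Proof.
move=> regL; pose N i := projT1 (cid (regL i)).
have NP i : exists G : {set {set state (N i)}}, muller_recognises G (fun xi => L xi = i).
  exact: projT2 (cid (regL i)).
pose M := @Automaton X {dffun forall i, state (N i)}
  (fun q x => [ffun i => trans (q i) x]) [ffun i => init (N i)].
have runM xi n i : (run M xi n : {dffun forall i, state (N i)}) i = run (N i) xi n.
  elim: n => [|n IHn]; first by rewrite /run /= ffunE.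
  by rewrite !runE !mkseqS /at_ /ftrans !foldl_rcons /= ffunE; congr trans.
have /choice[col colP] : forall S : {set state M}, exists c, forall xi,
    inf_states xi S -> L xi = c.
  move=> S; have [[eta infS]|none] := pselect (exists xi, @inf_states X M xi S); last first.
    by exists (L (fun=> x0)) => xi infS; case: none; exists xi.
  exists (L eta) => xi infS'; have [G GP] := NP (L eta); apply/GP.
  have [T GT infT] := (GP eta).1 erefl; exists T => //.
  have img zeta := @inf_states_image X M (N (L eta)) (fun q => q (L eta)) zeta S
    (fun n => runM zeta n (L eta)).
  by rewrite (inf_states_uniq infT (img _ infS)); apply: img.
by exists M, col => xi S /colP.
Qed.

Definition represents L F := exists (M : automaton X) (col : {set state M} -> 'I_k) Mo m,
  [/\ colored L col, @embeds X k M col F Mo m, complete Mo m &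
    forall G, embeddable col G -> leF G F].

Lemma represents_exists L : (forall i, regular (fun xi => L xi = i)) ->
  exists F, represents L F.
Proof.
move=> /regular_colored[M [col colL]].
have [F [Mo [m [emb cpl univ]]]] := cycle_forest col x0.
by exists F, M, col, Mo, m.
Qed.

(** A reduction carries the embedding of [F] to the target, where [F'] is greatest. Conversely [F]
    embeds wherever [F'] does, and the simulation applies. *)
Lemma represents_le L L' F F' : represents L F -> represents L' F' ->
  leCA L L' <-> leF F F'.
Proof.
move=> [M [col [Mo [m [colL emb cpl _]]]]] [M' [col' [Mo' [m' [colL' emb' _ univ']]]]].
split=> [[g [cont_g gP]]|le_F].
  apply: univ'; apply: (embeddable_reduction cont_g colL colL' gP).
  by exists Mo, m.
have [No [n embN]] := leF_embeddable le_F (ex_intro _ Mo' (ex_intro _ m' emb')).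
exact: (simulation emb cpl embN colL colL').
Qed.

(** The identity reduction shows that two presentations of one partition have the same embeddable
    forests. *)
Lemma represents_machine (c0 c1 : X) F d F' : c1 != c0 ->
  represents (machine_partition c0 (F := F) d) F' -> leF F F' /\ leF F' F.
Proof.
move=> c10 [M [col [Mo [m [colL emb _ univ]]]]].
have colm := @machine_colored X c0 k F d.
have [g [cont_g gP]] := leCA_refl (machine_partition c0 (F := F) d).
split.
  apply: univ; apply: (embeddable_reduction cont_g colm colL gP).
  exact: (machine_embeddable d c10).
apply: (@embeddable_machine X c0 k F d).
by apply: (embeddable_reduction cont_g colL colm gP); exists Mo, m.
Qed.

End Presentation.

Lemma aperiodic_regular (X : finType) (L : word X -> Prop) : aperiodic L -> regular L.
Proof. by case=> M [F [_ rec]]; exists M, F. Qed.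

Theorem theorem4p1 (X : finType) (k : nat) :
  1 < #|X| -> 2 <= k ->
  quotient_iso (@leR X k) (@leA X k) /\
  quotient_iso (@leR X k) (@leF k) /\
  quotient_iso (@leA X k) (@leF k).
Proof.
move=> /card_gt1P[c1 [c0 [_ _ c10]]] _.
have node_of (F : FTk k) : node F.
  have x := Ordinal (fsize_gt0 F); exact: (mknode (Ordinal (fsize_gt0 (proj1_sig (flab x))))).
pose mach F : Ak X k := exist _ (machine_partition c0 (node_of F))
  (machine_partition_aperiodic c0 (node_of F)).
have aper_reg (L : Ak X k) i := aperiodic_regular (proj2_sig L i).
pose toR (L : Ak X k) : Rk X k := exist _ (proj1_sig L) (aper_reg L).
have /choice[phi phiP] : forall L : Rk X k, exists F, represents (proj1_sig L) F.
  by move=> L; apply: (represents_exists c0) (proj2_sig L).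
have phi_mach F : leF F (phi (toR (mach F))) /\ leF (phi (toR (mach F))) F.
  exact: represents_machine c10 (phiP (toR (mach F))).
have phi_le (L L' : Rk X k) : leR L L' <-> leF (phi L) (phi L').
  exact: represents_le.
split; last split.
(* A regular partition is equivalent to the aperiodic one realizing its forest. *)
- exists (fun L => mach (phi L)); split=> [L L'|L].
    apply: (iff_trans (phi_le L L')).
    have [h1 h2] := phi_mach (phi L); have [h1' h2'] := phi_mach (phi L').
    apply: iff_trans (iff_sym (phi_le (toR (mach _)) (toR (mach _)))).
    by split=> h; [apply: leF_trans h2 (leF_trans h h1')|apply: leF_trans h1 (leF_trans h h2')].
  exists (toR L); have [h1 h2] := phi_mach (phi (toR L)).
  by split; [apply/(phi_le (toR (mach _)) (toR L))|apply/(phi_le (toR L) (toR (mach _)))].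
- exists phi; split=> [|F]; first exact: phi_le.
  by exists (toR (mach F)); have [] := phi_mach F.
- exists (fun L => phi (toR L)); split=> [L L'|F]; first exact: (phi_le (toR L) (toR L')).
  by exists (mach F); have [] := phi_mach F.
Qed.
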